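(* Let $f:2^{<\omega}\to\mathbb{N}$ be a total function having a recursive approximation $(f_s)_{s\in\omega}$ (so $f(\sigma)=\lim_s f_s(\sigma)$ for all $\sigma$) such that for every $i\in\mathbb{N}$, for all but finitely many $\sigma\in 2^{<\omega}$, and for all $s$, $f_s(\sigma)>i$. Then there exist a perfect $\Pi^0_1$ class $\mathcal{P}\subseteq 2^{\omega}$ and a constant $c$ such that for every $A\in\mathcal{P}$ and every $\sigma\in 2^{<\omega}$, $$K(\sigma)\le K^A(\sigma)+f(\sigma)+c.$$ Moreover, for every real $C\in 2^{\omega}$ there exist $A,B\in\mathcal{P}$ such that $C\le_T A\oplus B$.
   Context: $K$ denotes prefix-free Kolmogorov complexity and $K^A$ its relativization to the oracle $A$. A $\Pi^0_1$ class is the set of infinite paths through a computable binary tree; it is perfect if it is nonempty and has no isolated points. $A\oplus B$ is the Turing join of $A$ and $B$ and $\le_T$ denotes Turing reducibility. *)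

(* Defs.v *)
From mathcomp Require Import all_boot.
From mathcomp Require Import boolp classical_sets functions cardinality.
From mathcomp Require Import filter topology cantor.

Set Implicit Arguments.
Unset Strict Implicit.
Unset Printing Implicit Defensive.

Local Open Scope classical_set_scope.

(* Kleene's definition of the partial functions that are recursive in an
   oracle. Arities are not tracked: a program is run on a list of arguments,
   and a missing argument reads as 0. *)
Inductive program : Type :=
| Zero
| Succ
| Proj of nat
| Oracle
| Comp of program & seq program
| Prec of program & program
| Mu of program.

(* [computes A e v y]: the program e with oracle A halts on v with output y. *)
Fixpoint computes (A : nat -> bool) (e : program) (v : seq nat) (y : nat) : Prop :=
  match e with
  | Zero => y = 0
  | Succ => y = (nth 0 v 0).+1
  | Proj i => y = nth 0 v i
  | Oracle => y = A (nth 0 v 0)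
  | Comp f gs =>
      exists2 ws,
        (fix computes_all (gs : seq program) (ws : seq nat) : Prop :=
           match gs, ws with
           | [::], [::] => True
           | g :: gs', w :: ws' => computes A g v w /\ computes_all gs' ws'
           | _, _ => False
           end) gs ws
        & computes A f ws y
  | Prec f g =>
      (fix rec (n z : nat) : Prop :=
         if n is m.+1 then
           exists2 r, rec m r & computes A g (m :: r :: behead v) z
         else computes A f (behead v) z) (head 0 v) y
  | Mu f =>
      computes A f (y :: v) 0 /\
      forall m, m < y -> exists k, computes A f (m :: v) k.+1
  end.

(* Absolute computability is computability relative to the empty oracle. *)
Definition no_oracle : nat -> bool := fun=> false.

(* Programs read and write binary strings through the bijection [strnum] onto
   nat (bijective base 2, the head of the list being the least significant
   digit). *)
Fixpoint strnum (s : seq bool) : nat :=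
  if s is b :: s' then (strnum s').*2 + b.+1 else 0.

Definition turing_le (C D : cantor_space) : Prop :=
  exists e, forall n, computes D e [:: n] (C n).

Definition turing_join (A B : cantor_space) : cantor_space :=
  fun n => if odd n then B n./2 else A n./2.

Definition recursive_approximation (fs : nat -> seq bool -> nat) : Prop :=
  exists e, forall s sigma, computes no_oracle e [:: s; strnum sigma] (fs s sigma).

Definition computable_tree (T : seq bool -> bool) : Prop :=
  (exists e, forall sigma, computes no_oracle e [:: strnum sigma] (T sigma)) /\
  (forall sigma tau, prefix sigma tau -> T tau -> T sigma).

Definition paths (T : seq bool -> bool) : set cantor_space :=
  [set A | forall n, T (mkseq A n)].

Definition Pi01_class (P : set cantor_space) : Prop :=
  exists2 T, computable_tree T & P = paths T.

(* Closedness is not repeated here: it holds for every Pi^0_1 class. *)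
Definition perfect (P : set cantor_space) : Prop :=
  P !=set0 /\ isolated P = set0.

(* [tau] is a description of [sigma] for the oracle machine M with oracle A. *)
Definition describes (M : program) (A : nat -> bool) (tau sigma : seq bool) : Prop :=
  computes A M [:: strnum tau] (strnum sigma).

Definition prefix_free_machine (M : program) : Prop :=
  forall A tau tau' sigma sigma',
    describes M A tau sigma -> describes M A tau' sigma' ->
    prefix tau tau' -> tau = tau'.

(* The machines that may be used to define K. The constant d depends neither on
   the oracle nor on the string. Machines U such that U^A(rho tau) = M^A(tau)
   for some rho depending only on M are a special case. *)
Definition universal_machine (U : program) : Prop :=
  prefix_free_machine U /\
  forall M, prefix_free_machine M ->
    exists d, forall A tau sigma, describes M A tau sigma ->
      exists2 tau', describes U A tau' sigma & size tau' <= size tau + d.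

Definition has_description (U : program) (A : nat -> bool) (sigma : seq bool)
    (n : nat) : bool :=
  `[< exists2 tau, describes U A tau sigma & size tau = n >].

(* K^A(sigma). The value 0 for strings without a description is never used when
   U is universal. *)
Definition K_rel (U : program) (A : nat -> bool) (sigma : seq bool) : nat :=
  if pselect (exists n, has_description U A sigma n) is left h
  then ex_minn h else 0.

Definition K (U : program) (sigma : seq bool) : nat := K_rel U no_oracle sigma.

(* Main.v *)
Require Import Defs.
From mathcomp Require Import all_boot all_order all_algebra.
From mathcomp Require Import boolp classical_sets functions cardinality.
From mathcomp Require Import filter topology cantor.
From mathcomp Require Import zify ring lra.

(* The class P consists of the reals that agree with a limit-computable real off
   a co-c.e. set D of free positions and are arbitrary on D. Two members of P
   that differ exactly on D compute D, and one of them can code any real C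
   along D.

   When U with oracle X is seen to map tau to sigma, X being a finite string
   compatible with the current template of fixed and free positions, a
   description of sigma of length |tau| + f_s(sigma) is requested. An action of
   level i may follow: it fixes the free positions below |X|, except the first
   i ones, to the values of X, so that the computation is shared by 2^i branches
   at most. The requests made for strings that are no longer compatible are
   wasted, and the Kraft-Chaitin theorem needs the total weight to be bounded.
   Level i acts if f_s(sigma) is below a threshold that counts the actions of
   lower level (a forced action), or if the requests on X that use more than i
   free positions weigh at least a tolerance that is halved by every forced
   action of level i. The requests of higher level that survive thus weigh
   little: the threshold pays for the waste of the actions of lower level, the
   tolerance for the waste of the actions of level i itself. Because f_s(sigma)
   exceeds any bound for almost all sigma, finitely many requests force level i;
   the unforced actions of level i each save a fixed amount of a bounded weight.
   So every level acts finitely often and D is infinite. *)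

Set Implicit Arguments.
Unset Strict Implicit.
Unset Printing Implicit Defensive.

Import Order.TTheory GRing.Theory Num.Theory.

(** * Programs *)

Section ProgramInd.
Variable P : program -> Prop.
Hypothesis P_zero : P Zero.
Hypothesis P_succ : P Succ.
Hypothesis P_proj : forall i, P (Proj i).
Hypothesis P_oracle : P Oracle.
Hypothesis P_comp :
  forall f gs, P f -> foldr (fun g Q => P g /\ Q) True gs -> P (Comp f gs).
Hypothesis P_prec : forall f g, P f -> P g -> P (Prec f g).
Hypothesis P_mu : forall f, P f -> P (Mu f).

(** The programs in the list of a [Comp] need induction hypotheses of their own; the [foldr] in
    [P_comp] collects them. *)
Fixpoint program_nested_ind (e : program) : P e :=
  match e with
  | Zero => P_zero
  | Succ => P_succ
  | Proj i => P_proj i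
  | Oracle => P_oracle
  | Comp f gs =>
      P_comp (program_nested_ind f)
        ((fix all_P gs : foldr (fun g Q => P g /\ Q) True gs :=
            if gs is g :: gs' then conj (program_nested_ind g) (all_P gs')
            else I) gs)
  | Prec f g => P_prec (program_nested_ind f) (program_nested_ind g)
  | Mu f => P_mu (program_nested_ind f)
  end.
End ProgramInd.

(** The local fixpoint of [computes] under [Comp] gets a name, so that inductions on the list of
    programs can be stated. [rec_graph] does the same for [Prec]. *)
Fixpoint computes_all (A : nat -> bool) gs v ws : Prop :=
  match gs, ws with
  | [::], [::] => True
  | g :: gs', w :: ws' => computes A g v w /\ computes_all A gs' v ws'
  | _, _ => False
  end.

Lemma computes_compE A f gs v y :
  computes A (Comp f gs) v y <->
  exists2 ws, computes_all A gs v ws & computes A f ws y.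
Proof.
have E : forall hs ws,
    (fix computes_all (gs : seq program) (ws : seq nat) : Prop :=
           match gs, ws with
           | [::], [::] => True
           | g :: gs', w :: ws' => computes A g v w /\ computes_all gs' ws'
           | _, _ => False
           end) hs ws <-> computes_all A hs v ws.
  by elim=> [|h hs IH] [|w ws] //=; rewrite IH.
by split=> -[ws /E ? ?]; exists ws => //; apply/E.
Qed.

Fixpoint rec_graph (A : nat -> bool) f g v (n z : nat) : Prop :=
  if n is m.+1 then
    exists2 r, rec_graph A f g v m r & computes A g (m :: r :: v) z
  else computes A f v z.

Lemma computes_precE A f g v y :
  computes A (Prec f g) v y <-> rec_graph A f g (behead v) (head 0 v) y.
Proof.
rewrite /=; elim: (head 0 v) y => [|m IH] y //=.
by split=> -[r /IH ? ?]; exists r => //; apply/IH.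
Qed.

Lemma computes_prec A f g v n (F : nat -> nat) :
  computes A f v (F 0) ->
  (forall m, m < n -> computes A g (m :: F m :: v) (F m.+1)) ->
  computes A (Prec f g) (n :: v) (F n).
Proof.
move=> f0 gS; apply/computes_precE => /=.
suff: forall m, m <= n -> rec_graph A f g v m (F m) by apply.
elim=> [//|m IH] mn /=; exists (F m); [exact/IH/ltnW | exact: gS].
Qed.

Lemma computes_comp1 A f g v w y :
  computes A g v w -> computes A f [:: w] y -> computes A (Comp f [:: g]) v y.
Proof. by move=> ? ?; apply/computes_compE; exists [:: w]. Qed.

Lemma computes_comp2 A f g1 g2 v w1 w2 y :
  computes A g1 v w1 -> computes A g2 v w2 -> computes A f [:: w1; w2] y ->
  computes A (Comp f [:: g1; g2]) v y.
Proof. by move=> ? ? ?; apply/computes_compE; exists [:: w1; w2]. Qed.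

Lemma computes_comp3 A f g1 g2 g3 v w1 w2 w3 y :
  computes A g1 v w1 -> computes A g2 v w2 -> computes A g3 v w3 ->
  computes A f [:: w1; w2; w3] y ->
  computes A (Comp f [:: g1; g2; g3]) v y.
Proof. by move=> ? ? ? ?; apply/computes_compE; exists [:: w1; w2; w3]. Qed.

Lemma computes_proj A i v : computes A (Proj i) v (nth 0 v i).
Proof. by []. Qed.

Fixpoint const_prog n := if n is m.+1 then Comp Succ [:: const_prog m] else Zero.

Lemma computes_const A n v : computes A (const_prog n) v n.
Proof. by elim: n => [//|n IH]; apply: computes_comp1 IH _. Qed.

Definition add_prog := Prec (Proj 0) (Comp Succ [:: Proj 1]).

Lemma computes_add A m n : computes A add_prog [:: m; n] (m + n).
Proof.
apply: (@computes_prec _ _ _ [:: n] m (addn^~ n)) => // k _.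
exact: (@computes_comp1 _ _ _ _ (k + n)).
Qed.

Definition pred_prog := Prec Zero (Proj 0).

Lemma computes_pred A n : computes A pred_prog [:: n] n.-1.
Proof. exact: (@computes_prec _ _ _ [::] n predn). Qed.

(** Recursion runs on the first argument, hence the reversed order: the first argument is subtracted
    from the second. *)
Definition sub_prog := Prec (Proj 0) (Comp pred_prog [:: Proj 1]).

Lemma computes_sub A m n : computes A sub_prog [:: m; n] (n - m).
Proof.
apply: (@computes_prec _ _ _ [:: n] m (subn n)); first by rewrite /= subn0.
move=> k _; apply: computes_comp1 => [|/=]; first exact: computes_proj.
by rewrite /= subnS; exact: computes_pred.
Qed.

Definition sign_prog := Prec Zero (const_prog 1).

Lemma computes_sign A n : computes A sign_prog [:: n] (0 < n).
Proof.
apply: (@computes_prec _ _ _ [::] n (fun n => 0 < n : nat)) => // m _.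
exact: (computes_const A 1).
Qed.

(** * The Cantor pairing *)

Fixpoint tri n := if n is m.+1 then tri m + m.+1 else 0.

Definition tri_prog :=
  Prec Zero (Comp add_prog [:: Proj 1; Comp Succ [:: Proj 0]]).

Lemma computes_tri A n : computes A tri_prog [:: n] (tri n).
Proof.
apply: (@computes_prec _ _ _ [::] n tri) => // m _.
apply: computes_comp2; [exact: computes_proj | | exact: computes_add].
exact: (@computes_comp1 _ _ _ _ m).
Qed.

Lemma leq_tri m n : m <= n -> tri m <= tri n.
Proof. by elim: n => [|n IH]; [case: m | rewrite leq_eqVlt => /predU1P[->|/IH] //=; lia]. Qed.

Definition pair_nat a b := tri (a + b) + b.

Definition pair_prog :=
  Comp add_prog [:: Comp tri_prog [:: add_prog]; Proj 1].

Lemma computes_pair A a b : computes A pair_prog [:: a; b] (pair_nat a b).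
Proof.
apply: computes_comp2; [|exact: computes_proj|exact: computes_add].
by apply: computes_comp1; [exact: computes_add | exact: computes_tri].
Qed.

(* The largest w with [tri w <= n] is the least w with [n < tri w.+1]. *)
Definition diag_prog :=
  Mu (Comp sub_prog [:: Comp tri_prog [:: Comp Succ [:: Proj 0]];
                        Comp Succ [:: Proj 1]]).

Lemma computes_diag A a b : computes A diag_prog [:: pair_nat a b] (a + b).
Proof.
have body w n : computes A
   (Comp sub_prog [:: Comp tri_prog [:: Comp Succ [:: Proj 0]]; Comp Succ [:: Proj 1]])
   [:: w; n] (n.+1 - tri w.+1).
  apply: computes_comp2; [|by apply: computes_comp1|exact: computes_sub].
  by apply: computes_comp1; [exact: (@computes_comp1 _ _ _ _ w) | exact: computes_tri].
split; last first.
  move=> m mlt; exists (pair_nat a b - tri m.+1).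
  rewrite -subSn; first exact: body.
  by rewrite /pair_nat (leq_trans (leq_tri mlt)) ?leq_addr.
have /= := body (a + b) (pair_nat a b).
by have -> : (pair_nat a b).+1 - (tri (a + b) + (a + b).+1) = 0
  by rewrite /pair_nat; lia.
Qed.

Definition snd_prog := Comp sub_prog [:: Comp tri_prog [:: diag_prog]; Proj 0].

Lemma computes_snd A a b : computes A snd_prog [:: pair_nat a b] b.
Proof.
apply: computes_comp2.
- by apply: computes_comp1; [exact: computes_diag | exact: computes_tri].
- exact: computes_proj.
- by have := computes_sub A (tri (a + b)) (pair_nat a b); rewrite {2}/pair_nat addKn.
Qed.

Definition fst_prog := Comp sub_prog [:: snd_prog; diag_prog].

Lemma computes_fst A a b : computes A fst_prog [:: pair_nat a b] a.
Proof.
apply: computes_comp2; [exact: computes_snd | exact: computes_diag |].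
by have := computes_sub A b (a + b); rewrite addnK.
Qed.

Lemma pair_nat_inj a b a' b' : pair_nat a b = pair_nat a' b' -> a = a' /\ b = b'.
Proof.
wlog le_ab : a b a' b' / a + b <= a' + b'.
  by move=> H E; case: (leqP (a + b) (a' + b')) => [/H|/ltnW /H] -/(_ _) => [/(_ E)|/(_ (esym
    E)) []].
rewrite /pair_nat; case: ltngtP le_ab => // [lt_ab|eq_ab] _ E; last by rewrite eq_ab in E; lia.
have := leq_tri lt_ab => /=; lia.
Qed.

Lemma leq_pair_nat_r a b : b <= pair_nat a b.
Proof. exact: leq_addl. Qed.

(** * Computable functions between encoded types *)

Class Enc (T : Type) := { enc : T -> nat; enc_inj : injective enc }.

#[export] Instance enc_nat : Enc nat := {| enc := id; enc_inj := fun _ _ => id |}.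

Lemma nat_of_bool_inj : injective nat_of_bool.
Proof. by move=> [] []. Qed.

#[export] Instance enc_bool : Enc bool := {| enc := nat_of_bool; enc_inj := nat_of_bool_inj |}.

Section EncInstances.
Context {S T : Type} {eS : Enc S} {eT : Enc T}.

Definition enc_pair_fun (x : S * T) := pair_nat (enc x.1) (enc x.2).
Lemma enc_pair_inj : injective enc_pair_fun.
Proof. by move=> [a b] [c d] /pair_nat_inj[/(@enc_inj S eS) /= -> /(@enc_inj T eT) /= ->]. Qed.
#[export] Instance enc_pair : Enc (S * T) := {| enc_inj := enc_pair_inj |}.

Definition enc_option_fun (x : option T) := if x is Some y then (enc y).+1 else 0.
Lemma enc_option_inj : injective enc_option_fun.
Proof. by move=> [a|] [b|] // [] /(@enc_inj T eT) ->. Qed.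
#[export] Instance enc_option : Enc (option T) := {| enc_inj := enc_option_inj |}.

Fixpoint enc_seq_fun (s : seq T) := if s is x :: s' then (pair_nat (enc x) (enc_seq_fun s')).+1
  else 0.
Lemma enc_seq_inj : injective enc_seq_fun.
Proof. by elim=> [|a s IH] [|b t] // [] /pair_nat_inj[/(@enc_inj T eT) -> /IH ->]. Qed.
#[export] Instance enc_seq : Enc (seq T) := {| enc_inj := enc_seq_inj |}.

Lemma size_enc_seq (s : seq T) : size s <= enc s.
Proof. by elim: s => //= x s IH; rewrite ltnS (leq_trans IH) ?leq_pair_nat_r. Qed.
End EncInstances.

(** [O] tells which oracles the program must cope with: [xpredT] asks for one program that is
    correct with every oracle, [eq D] for one that may consult [D]. *)
Definition computable (O : (nat -> bool) -> Prop) {S T} {eS : Enc S} {eT : Enc T} (f : S -> T) :=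
  exists e, forall A x, O A -> computes A e [:: enc x] (enc (f x)).

Section Combinators.
Variable O : (nat -> bool) -> Prop.
Context {R S T U : Type} {eR : Enc R} {eS : Enc S} {eT : Enc T} {eU : Enc U}.
Implicit Types (f : S -> T).

Lemma computable_id : computable O (fun x : S => x).
Proof. by exists (Proj 0). Qed.

Lemma computable_const (t : T) : computable O (fun _ : S => t).
Proof. by exists (const_prog (enc t)) => A x _; exact: computes_const. Qed.

Lemma computable_comp (g : T -> U) f :
  computable O g -> computable O f -> computable O (fun x => g (f x)).
Proof.
move=> [e He] [e' He']; exists (Comp e [:: e']) => A x OA.
exact: (computes_comp1 (He' _ _ OA) (He _ _ OA)).
Qed.

Lemma computable_pair f (g : S -> U) :
  computable O f -> computable O g -> computable O (fun x => (f x, g x)).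
Proof.
move=> [e He] [e' He']; exists (Comp pair_prog [:: e; e']) => A x OA.
exact: (computes_comp2 (He _ _ OA) (He' _ _ OA) (computes_pair _ _ _)).
Qed.

Lemma computable_fst (f : S -> T * U) :
  computable O f -> computable O (fun x => (f x).1).
Proof.
move=> [e He]; exists (Comp fst_prog [:: e]) => A x OA.
exact: (computes_comp1 (He _ _ OA) (computes_fst _ _ _)).
Qed.

Lemma computable_snd (f : S -> T * U) :
  computable O f -> computable O (fun x => (f x).2).
Proof.
move=> [e He]; exists (Comp snd_prog [:: e]) => A x OA.
exact: (computes_comp1 (He _ _ OA) (computes_snd _ _ _)).
Qed.

Lemma computable_enc f : computable O f -> computable O (fun x => enc (f x)).
Proof. by []. Qed.

Lemma computable_bool (f : S -> bool) :
  computable O f -> computable O (fun x => f x : nat).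
Proof. by []. Qed.

Lemma computable_some f : computable O f -> computable O (fun x => Some (f x)).
Proof.
move=> [e He]; exists (Comp Succ [:: e]) => A x OA.
exact: (computes_comp1 (He _ _ OA)).
Qed.

Lemma computable_cons f (s : S -> seq T) :
  computable O f -> computable O s -> computable O (fun x => f x :: s x).
Proof.
move=> [e He] [e' He']; exists (Comp Succ [:: Comp pair_prog [:: e; e']]) => A x OA.
apply: computes_comp1; last by [].
exact: (computes_comp2 (He _ _ OA) (He' _ _ OA) (computes_pair _ _ _)).
Qed.

Lemma computable_succ (n : S -> nat) :
  computable O n -> computable O (fun x => (n x).+1).
Proof.
move=> [e He]; exists (Comp Succ [:: e]) => A x OA.
exact: (computes_comp1 (He _ _ OA)).
Qed.

Lemma computable_nat2 (F : nat -> nat -> nat) e (m n : S -> nat) :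
  (forall A m n, computes A e [:: m; n] (F m n)) ->
  computable O m -> computable O n -> computable O (fun x => F (m x) (n x)).
Proof.
move=> HF [e1 He1] [e2 He2]; exists (Comp e [:: e1; e2]) => A x OA.
exact: (computes_comp2 (He1 _ _ OA) (He2 _ _ OA) (HF _ _ _)).
Qed.

Lemma computable_add (m n : S -> nat) :
  computable O m -> computable O n -> computable O (fun x => m x + n x).
Proof. exact: computable_nat2 computes_add. Qed.

Lemma computable_sub (m n : S -> nat) :
  computable O m -> computable O n -> computable O (fun x => m x - n x).
Proof. by move=> ? ?; apply: (computable_nat2 (F := fun m n => n - m) computes_sub). Qed.

Lemma computable_iteri (n : S -> nat) (a : S -> T) (g : S -> nat -> T -> T) :
  computable O n -> computable O a ->
  computable O (fun p : S * (nat * T) => g p.1 p.2.1 p.2.2) ->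
  computable O (fun x => iteri (n x) (g x) (a x)).
Proof.
move=> [en Hn] [ea Ha] [eg Hg].
pose step := Comp eg [:: Comp pair_prog [:: Proj 2; Comp pair_prog [:: Proj 0; Proj 1]]].
exists (Comp (Prec ea step) [:: en; Proj 0]) => A x OA.
apply: computes_comp2; [exact: Hn | exact: computes_proj | rewrite [nth _ _ _]/=].
apply: (@computes_prec _ _ _ [:: enc x] (n x) (fun n => enc (iteri n (g x) (a x)))).
  exact: Ha.
move=> m _; apply: computes_comp1; last exact: (Hg _ (x, (m, iteri m (g x) (a x))) OA).
apply: computes_comp2; [exact: computes_proj | | exact: computes_pair].
by apply: computes_comp2; [exact: computes_proj | exact: computes_proj | exact: computes_pair].
Qed.

Lemma computable_iter (n : S -> nat) (a : S -> T) (g : S -> T -> T) :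
  computable O n -> computable O a ->
  computable O (fun p : S * (nat * T) => g p.1 p.2.2) ->
  computable O (fun x => iter (n x) (g x) (a x)).
Proof.
move=> Hn Ha Hg.
have [e He] := @computable_iteri n a (fun x _ => g x) Hn Ha Hg.
exists e => A x OA; have := He A x OA; congr (computes _ _ _ (enc _)).
Qed.

(* The branch not taken may diverge, so it must not be evaluated: the recursion
   runs for at most one step. *)
Lemma computable_case_code (n : S -> nat) (a h : S -> T) (g : S -> U -> T) :
  (forall x, n x = 0 -> h x = a x) ->
  (forall x, 0 < n x -> exists2 u, (n x).-1 = enc u & h x = g x u) ->
  computable O n -> computable O a ->
  computable O (fun p : S * U => g p.1 p.2) -> computable O h.
Proof.
move=> h0 hS [en Hn] [ea Ha] [eg Hg].
pose step := Comp eg [:: Comp pair_prog [:: Proj 2; Proj 3]].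
pose base := Comp ea [:: Proj 0].
exists (Comp (Prec base step)
  [:: Comp sign_prog [:: en]; Proj 0; Comp pred_prog [:: en]]) => A x OA.
apply: (computes_comp3 (w1 := 0 < n x) (w2 := enc x) (w3 := (n x).-1)) => //.
- exact: computes_comp1 (Hn _ _ OA) (computes_sign _ _).
- exact: computes_comp1 (Hn _ _ OA) (computes_pred _ _).
have base_a y : computes A base [:: enc x; y] (enc (a x)).
  by apply: computes_comp1 (Ha _ _ OA); exact: computes_proj.
case: (posnP (n x)) => [n0|n_gt0].
  by apply: (@computes_prec _ _ _ [:: enc x; (n x).-1] 0 (fun=> enc (h x))); rewrite ?h0.
have [u nu hu] := hS _ n_gt0.
apply: (@computes_prec _ _ _ [:: enc x; (n x).-1] 1
  (fun m => enc (if 0 < m then h x else a x))) => [|m]; first exact: base_a.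
rewrite ltnS leqn0 => /eqP ->; rewrite hu nu.
apply: computes_comp1; last exact: (Hg _ (x, u) OA).
by apply: computes_comp2 (computes_pair _ _ _); exact: computes_proj.
Qed.

End Combinators.

Section Cases.
Variable O : (nat -> bool) -> Prop.
Context {S T U : Type} {eS : Enc S} {eT : Enc T} {eU : Enc U}.

Lemma computable_if (b : S -> bool) (f g : S -> T) :
  computable O b -> computable O f -> computable O g ->
  computable O (fun x => if b x then f x else g x).
Proof.
move=> Hb Hf Hg.
apply: (@computable_case_code O S T nat _ _ _ (fun x => b x) g _ (fun x _ => f x)) => //.
- by move=> x; case: (b x).
- by move=> x; case: (b x) => // _; exists 0.
- by apply: (computable_comp Hf); apply: computable_fst; exact: computable_id.
Qed.

Lemma computable_case_nat (n : S -> nat) (a : S -> T) (g : S -> nat -> T) :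
  computable O n -> computable O a ->
  computable O (fun p : S * nat => g p.1 p.2) ->
  computable O (fun x => if n x is m.+1 then g x m else a x).
Proof.
move=> Hn Ha Hg; apply: computable_case_code Hn Ha Hg => x; first by move=> ->.
by case: (n x) => // m _; exists m.
Qed.

Lemma computable_case_option (o : S -> option U) (a : S -> T) (g : S -> U -> T) :
  computable O o -> computable O a ->
  computable O (fun p : S * U => g p.1 p.2) ->
  computable O (fun x => if o x is Some u then g x u else a x).
Proof.
move=> Ho Ha Hg.
apply: (computable_case_code (n := fun x => enc (o x)) _ _ Ho Ha Hg) => x.
  by case: (o x).
by case: (o x) => // u _; exists u.
Qed.

Lemma computable_case_seq (s : S -> seq U) (a : S -> T) (g : S -> U -> seq U -> T) :
  computable O s -> computable O a ->
  computable O (fun p : S * (U * seq U) => g p.1 p.2.1 p.2.2) ->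
  computable O (fun x => if s x is u :: s' then g x u s' else a x).
Proof.
move=> Hs Ha Hg.
apply: (@computable_case_code O S T (U * seq U) _ _ _ (fun x => enc (s x))
  a _ (fun x p => g x p.1 p.2)) => // x; first by case: (s x).
by case: (s x) => // u s' _; exists (u, s').
Qed.

End Cases.

Section Folds.
Variable O : (nat -> bool) -> Prop.
Context {S T U : Type} {eS : Enc S} {eT : Enc T} {eU : Enc U}.

(** The fold is an iteration on pairs of an accumulator and a remaining list. The code of the list
    bounds its length and serves as the number of rounds; once the list is exhausted, the further
    rounds change nothing. *)
Lemma computable_foldl (F : S -> T -> U -> T) (a : S -> T) (s : S -> seq U) :
  computable O a -> computable O s ->
  computable O (fun p : S * (T * U) => F p.1 p.2.1 p.2.2) ->
  computable O (fun x => foldl (F x) (a x) (s x)).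
Proof.
move=> Ha Hs HF.
pose step x (p : T * seq U) :=
  if p.2 is u :: s' then (F x p.1 u, s') else p.
have Hstep : computable O (fun p : S * (nat * (T * seq U)) => step p.1 p.2.2).
  apply: (@computable_case_seq O (S * (nat * (T * seq U))) (T * seq U) U _ _ _
    (fun p => p.2.2.2) (fun p => p.2.2) (fun p u s' => (F p.1 p.2.2.1 u, s'))).
  - by do 3!apply: computable_snd; exact: computable_id.
  - by do 2!apply: computable_snd; exact: computable_id.
  apply: computable_pair; last by do 2!apply: computable_snd; exact: computable_id.
  apply: (computable_comp (f := fun p : (S * (nat * (T * seq U))) * (U * seq U) =>
     (p.1.1, (p.1.2.2.1, p.2.1))) HF).
  apply: computable_pair; first by do 2!apply: computable_fst; exact: computable_id.
  apply: computable_pair; last by apply: computable_fst; apply: computable_snd;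
    exact: computable_id.
  apply: computable_fst; do 2!apply: computable_snd; apply: computable_fst; exact: computable_id.
have Hiter := computable_iter (computable_enc Hs) (computable_pair Ha Hs) Hstep.
have [e He] := computable_fst Hiter.
exists e => A x OA; have := He A x OA; congr (computes _ _ _ (enc _)).
set n := (X in iter X _ _).
have: size (s x) <= n by exact: size_enc_seq.
clearbody n; elim: n (s x) (a x) => [|n IH] [|u s'] b // sz; rewrite iterSr.
  exact: (IH [::]).
exact: (IH s').
Qed.
End Folds.

Lemma computable_ext O {S T} {eS : Enc S} {eT : Enc T} (f g : S -> T) :
  f =1 g -> computable O f -> computable O g.
Proof. by move=> fg [e He]; exists e => A x OA; rewrite -fg; exact: He. Qed.

(** A hook, redefined as closure under further operations becomes available. *)
Ltac computable_user := fail.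

Ltac computable_step :=
  cbv beta;
  lazymatch goal with
  | H : computable ?O ?f |- computable ?O ?f => exact H
  | H : computable ?O ?f |- computable ?O (fun x => ?f (@?g x)) =>
      apply: (computable_comp (g := f) (f := g) H)
  | |- computable _ (fun x => x) => apply: computable_id
  | |- computable _ (fun _ => ?t) => apply: computable_const
  | |- computable _ fst => apply: (computable_fst (f := fun x => x))
  | |- computable _ snd => apply: (computable_snd (f := fun x => x))
  | |- computable _ (fun x => (_, _)) => apply: computable_pair
  | |- computable _ (fun x => fst _) => apply: computable_fst
  | |- computable _ (fun x => snd _) => apply: computable_snd
  | |- computable _ (fun x => Some _) => apply: computable_some
  | |- computable _ (fun x => _ :: _) => apply: computable_cons
  | |- computable _ (fun x => nat_of_bool _) => apply: computable_bool
  | |- computable _ (fun x => enc _) => apply: computable_enc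
  | |- computable _ (fun x => S _) => apply: computable_succ
  | |- computable _ (fun x => addn _ _) => apply: computable_add
  | |- computable _ (fun x => subn _ _) => apply: computable_sub
  | |- computable _ (fun x => iteri _ _ _) => apply: computable_iteri
  | |- computable _ (fun x => iter _ _ _) => apply: computable_iter
  | |- computable _ (fun x => foldl _ _ _) => apply: computable_foldl
  | |- computable _ (fun x => if _ is m.+1 then _ else _) => apply: computable_case_nat
  | |- computable _ (fun x => if _ is Some _ then _ else _) => apply: computable_case_option
  | |- computable _ (fun x => if _ is _ :: _ then _ else _) => apply: computable_case_seq
  | |- computable _ (fun x => if _ then _ else _) => apply: computable_if
  | _ => computable_user
  end.

Ltac computability := repeat computable_step.

Lemma computable_and O {S} {eS : Enc S} (a b : S -> bool) :
  computable O a -> computable O b -> computable O (fun x => a x && b x).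
Proof. by move=> Ha Hb; apply: (computable_ext (f := fun x => if a x then b x else false)) =>
  //; computability. Qed.

Lemma computable_or O {S} {eS : Enc S} (a b : S -> bool) :
  computable O a -> computable O b -> computable O (fun x => a x || b x).
Proof. by move=> Ha Hb; apply: (computable_ext (f := fun x => if a x then true else b x)) =>
  //; computability. Qed.

Lemma computable_neg O {S} {eS : Enc S} (a : S -> bool) : computable O a -> computable O (fun x
  => ~~ a x).
Proof. by move=> Ha; apply: (computable_ext (f := fun x => if a x then false else true)) => //;
  computability. Qed.

Lemma computable_leq O {S} {eS : Enc S} (m n : S -> nat) :
  computable O m -> computable O n -> computable O (fun x => m x <= n x).
Proof.
move=> Hm Hn.
apply: (computable_ext (f := fun x => if m x - n x is _.+1 then false else true)).
  by move=> x; rewrite -subn_eq0; case: (_ - _).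
by computability.
Qed.

Lemma computable_eqn O {S} {eS : Enc S} (m n : S -> nat) :
  computable O m -> computable O n -> computable O (fun x => m x == n x).
Proof.
move=> Hm Hn; apply: (computable_ext (f := fun x => (m x <= n x) && (n x <= m x))).
  by move=> x; rewrite eqn_leq.
by apply: computable_and; exact: computable_leq.
Qed.

Lemma computable_eqb O {S} {eS : Enc S} (a b : S -> bool) :
  computable O a -> computable O b -> computable O (fun x => a x == b x).
Proof.
move=> Ha Hb; apply: (computable_ext (f := fun x => (a x : nat) == b x));
  last exact: computable_eqn.
by move=> x; case: (a x); case: (b x).
Qed.

Lemma computable_mul O {S} {eS : Enc S} (m n : S -> nat) :
  computable O m -> computable O n -> computable O (fun x => m x * n x).
Proof.
move=> Hm Hn; apply: (computable_ext (f := fun x => iter (m x) (fun r => n x + r) 0)).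
  by move=> x; rewrite iter_addn_0 mulnC.
by computability.
Qed.

Lemma computable_exp O {S} {eS : Enc S} (m n : S -> nat) :
  computable O m -> computable O n -> computable O (fun x => m x ^ n x).
Proof.
move=> Hm Hn; apply: (computable_ext (f := fun x => iter (n x) (fun r => m x * r) 1)).
  by move=> x; elim: (n x) => //= k ->; rewrite expnS.
by computability; apply: computable_mul; computability.
Qed.


Ltac computable_user ::=
  lazymatch goal with
  | |- computable _ (fun x => _ && _) => apply: computable_and
  | |- computable _ (fun x => _ || _) => apply: computable_or
  end.

Lemma computable_rev O {S T} {eS : Enc S} {eT : Enc T} (s : S -> seq T) :
  computable O s -> computable O (fun x => rev (s x)).
Proof.
move=> Hs; apply: (computable_ext (f := fun x => foldl (fun r a => a :: r) [::] (s x))).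
  move=> x; rewrite /rev; move: [::]; elim: (s x) => //= a l IH r; exact: IH.
by computability.
Qed.

Lemma computable_foldr O {S T U} {eS : Enc S} {eT : Enc T} {eU : Enc U} (F : S -> U -> T -> T)
  (a : S -> T) (s : S -> seq U) :
  computable O a -> computable O s ->
  computable O (fun p : S * (U * T) => F p.1 p.2.1 p.2.2) ->
  computable O (fun x => foldr (F x) (a x) (s x)).
Proof.
move=> Ha Hs HF.
apply: (computable_ext (f := fun x => foldl (fun r u => F x u r) (a x) (rev (s x)))).
  by move=> x; rewrite foldl_rev.
apply: computable_foldl => //; first exact: computable_rev.
by apply: (computable_comp (f := fun p : S * (T * U) => (p.1, (p.2.2, p.2.1))) HF); computability.
Qed.

Lemma computable_map O {S T U} {eS : Enc S} {eT : Enc T} {eU : Enc U} (F : S -> U -> T) (s : S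
  -> seq U) :
  computable O s -> computable O (fun p : S * U => F p.1 p.2) ->
  computable O (fun x => [seq F x u | u <- s x]).
Proof.
move=> Hs HF.
apply: (computable_ext (f := fun x => foldr (fun u r => F x u :: r) [::] (s x))) => //.
apply: computable_foldr => //; computability.
by apply: (computable_comp (f := fun p : S * (U * seq T) => (p.1, p.2.1)) HF); computability.
Qed.

Lemma computable_has O {S U} {eS : Enc S} {eU : Enc U} (F : S -> U -> bool) (s : S -> seq U) :
  computable O s -> computable O (fun p : S * U => F p.1 p.2) ->
  computable O (fun x => has (F x) (s x)).
Proof.
move=> Hs HF.
apply: (computable_ext (f := fun x => foldr (fun u r => F x u || r) false (s x))) => //.
apply: computable_foldr => //; computability.
by apply: (computable_comp (f := fun p : S * (U * bool) => (p.1, p.2.1)) HF); computability.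
Qed.

Lemma computable_all O {S U} {eS : Enc S} {eU : Enc U} (F : S -> U -> bool) (s : S -> seq U) :
  computable O s -> computable O (fun p : S * U => F p.1 p.2) ->
  computable O (fun x => all (F x) (s x)).
Proof.
move=> Hs HF.
apply: (computable_ext (f := fun x => foldr (fun u r => F x u && r) true (s x))) => //.
apply: computable_foldr => //; computability.
by apply: (computable_comp (f := fun p : S * (U * bool) => (p.1, p.2.1)) HF); computability.
Qed.

Lemma computable_count O {S U} {eS : Enc S} {eU : Enc U} (F : S -> U -> bool) (s : S -> seq U) :
  computable O s -> computable O (fun p : S * U => F p.1 p.2) ->
  computable O (fun x => count (F x) (s x)).
Proof.
move=> Hs HF.
apply: (computable_ext (f := fun x => foldr (fun u r => F x u + r) 0 (s x))) => //.
apply: computable_foldr => //; computability.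
by apply: (computable_comp (f := fun p : S * (U * nat) => (p.1, p.2.1)) HF); computability.
Qed.

Lemma computable_find O {S U} {eS : Enc S} {eU : Enc U} (F : S -> U -> bool) (s : S -> seq U) :
  computable O s -> computable O (fun p : S * U => F p.1 p.2) ->
  computable O (fun x => find (F x) (s x)).
Proof.
move=> Hs HF.
apply: (computable_ext (f := fun x => foldr (fun u r => if F x u then 0 else r.+1) 0 (s x))) => //.
apply: computable_foldr => //; computability.
by apply: (computable_comp (f := fun p : S * (U * nat) => (p.1, p.2.1)) HF); computability.
Qed.

Lemma computable_size O {S U} {eS : Enc S} {eU : Enc U} (s : S -> seq U) :
  computable O s -> computable O (fun x => size (s x)).
Proof.
move=> Hs.
apply: (computable_ext (f := fun x => foldr (fun _ r => r.+1) 0 (s x))) => //.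
by apply: computable_foldr => //; computability.
Qed.

Lemma computable_iota O {S} {eS : Enc S} (m n : S -> nat) :
  computable O m -> computable O n -> computable O (fun x => iota (m x) (n x)).
Proof.
move=> Hm Hn.
apply: (computable_ext (f := fun x => rev (iteri (n x) (fun i r => m x + i :: r) [::]))).
  move=> x; rewrite -[RHS]revK; congr rev.
  by elim: (n x) => // k IH; rewrite [LHS]/= IH -[in RHS]addn1 iotaD rev_cat.
by apply: computable_rev; computability.
Qed.

Lemma computable_nth O {S T} {eS : Enc S} {eT : Enc T} (d : T) (s : S -> seq T) (n : S -> nat) :
  computable O s -> computable O n -> computable O (fun x => nth d (s x) (n x)).
Proof.
move=> Hs Hn.
apply: (computable_ext (f := fun x =>
   if iter (n x) (fun r => if r is _ :: r' then r' else r) (s x) is y :: _ then y else d)).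
  move=> x; elim: (n x) (s x) => [|k IH] [|y r] //; rewrite iterSr //=.
    by rewrite IH nth_nil.
by computability.
Qed.

Ltac computable_user ::=
  lazymatch goal with
  | |- computable _ (fun x => _ && _) => apply: computable_and
  | |- computable _ (fun x => _ || _) => apply: computable_or
  | |- computable _ (fun x => ~~ _) => apply: computable_neg
  | |- computable _ (fun x => leq _ _) => apply: computable_leq
  | |- computable _ (fun x => muln _ _) => apply: computable_mul
  | |- computable _ (fun x => expn _ _) => apply: computable_exp
  | |- computable _ (fun x => eq_op _ _) => first [apply: computable_eqn | apply: computable_eqb]
  | |- computable _ (fun x => rev _) => apply: computable_rev
  | |- computable _ (fun x => foldr _ _ _) => apply: computable_foldr
  | |- computable _ (fun x => map _ _) => apply: computable_map
  | |- computable _ (fun x => has _ _) => apply: computable_has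
  | |- computable _ (fun x => all _ _) => apply: computable_all
  | |- computable _ (fun x => count _ _) => apply: computable_count
  | |- computable _ (fun x => find _ _) => apply: computable_find
  | |- computable _ (fun x => size _) => apply: computable_size
  | |- computable _ (fun x => iota _ _) => apply: computable_iota
  | |- computable _ (fun x => nth _ _ _) => apply: computable_nth
  end.

(** * Binary strings *)

Fixpoint string_succ (s : seq bool) :=
  if s is b :: s' then if b then false :: string_succ s' else true :: s'
  else [:: false].

Definition numstr n := iter n string_succ [::].

Lemma strnum_succ s : strnum (string_succ s) = (strnum s).+1.
Proof. by elim: s => [//|[] s IH] /=; rewrite ?IH; lia. Qed.

Lemma numstrK : cancel numstr strnum.
Proof. by elim=> //= n IH; rewrite strnum_succ IH. Qed.

Lemma strnum_inj : injective strnum.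
Proof.
elim=> [|b s IH] [|c t] //=; try lia.
(* The digits are 1 and 2, so the parity of the number determines the head. *)
move=> E; have [-> Es] : b = c /\ strnum s = strnum t.
  by case: b E; case: c => /=; lia.
by rewrite (IH t Es).
Qed.

Lemma strnumK : cancel strnum numstr.
Proof. by move=> s; apply: strnum_inj; rewrite numstrK. Qed.

Lemma leq_size_numstr m n : m <= n -> size (numstr m) <= size (numstr n).
Proof.
move=> /subnKC <-; elim: (n - m) => [|k IH]; first by rewrite addn0.
rewrite addnS (leq_trans IH) // [numstr _.+1]/= -/(numstr _).
by elim: (numstr (m + k)) => [|[] s IHs].
Qed.

(** [string_succ] needs the unchanged tail as well as the successor of the tail, so the fold carries
    both. *)
Lemma computable_numstr O {S} {eS : Enc S} (n : S -> nat) :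
  computable O n -> computable O (fun x => numstr (n x)).
Proof.
move=> Hn.
pose F b (p : seq bool * seq bool) :=
  (b :: p.1, if b then false :: p.2 else true :: p.1).
apply: (computable_ext (f := fun x =>
   iter (n x) (fun s => (foldr F ([::], [:: false]) s).2) [::])).
  move=> x; rewrite /numstr; elim: (n x) => //= k ->.
  suff -> s : foldr F ([::], [:: false]) s = (s, string_succ s) by [].
  by elim: s => //= b s ->; rewrite /F /=.
by rewrite /F; computability.
Qed.

Lemma computable_strnum O {S} {eS : Enc S} (s : S -> seq bool) :
  computable O s -> computable O (fun x => strnum (s x)).
Proof.
move=> Hs.
apply: (computable_ext (f := fun x =>
   foldr (fun (b : bool) n => n + n + b.+1) 0 (s x))).
  by move=> x; elim: (s x) => //= b t ->; rewrite addnn.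
by computability.
Qed.

(** * Removing the oracle *)

(** A program that is known to be correct for the empty oracle becomes correct for every oracle. *)
Fixpoint strip e :=
  match e with
  | Oracle => Zero
  | Comp f gs => Comp (strip f) [seq strip g | g <- gs]
  | Prec f g => Prec (strip f) (strip g)
  | Mu f => Mu (strip f)
  | _ => e
  end.

Lemma computes_strip A e v y : computes A (strip e) v y <-> computes no_oracle e v y.
Proof.
elim/program_nested_ind: e v y => //.
- move=> f gs IHf IHgs v y; rewrite [strip _]/= !computes_compE.
  have E ws : computes_all A [seq strip g | g <- gs] v ws <-> computes_all no_oracle gs v ws.
    by elim: gs IHgs ws => [|g gs IH] /= IHgs [|w ws] //; rewrite IHgs.1 IH //; case: IHgs.
  by split=> -[ws /E ? /IHf ?]; exists ws.
- move=> f g IHf IHg v y; rewrite [strip _]/= !computes_precE.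
  elim: (head 0 v) y => [|m IH] y //=; split=> -[r /IH ? /IHg ?]; exists r => //.
- move=> f IHf v y /=; split=> -[/IHf ? H]; split=> // m /H [k /IHf ?]; exists k => //.
Qed.

(** * Evaluation with a finite oracle *)

(** Only the search of [Mu] needs the bound [t]; the other constructs terminate by themselves. A
    query beyond the end of [X] makes the evaluation fail, so a result depends on no more of the
    oracle than [X]. The counter of [Mu] stops at the first value that is zero or undefined, and the
    final test tells these apart. *)
Fixpoint ev (t : nat) (X : seq bool) (e : program) (v : seq nat) : option nat :=
  match e with
  | Zero => Some 0
  | Succ => Some (nth 0 v 0).+1
  | Proj i => Some (nth 0 v i)
  | Oracle =>
      if nth 0 v 0 < size X then Some (nat_of_bool (nth false X (nth 0 v 0)))
      else None
  | Comp f gs =>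
      if foldr (fun g r =>
           if ev t X g v is Some w then if r is Some ws then Some (w :: ws) else None
           else None) (Some [::]) gs is Some ws
      then ev t X f ws else None
  | Prec f g =>
      iteri (head 0 v)
        (fun m r => if r is Some z then ev t X g (m :: z :: behead v) else None)
        (ev t X f (behead v))
  | Mu f =>
      let y := iter t (fun y => if ev t X f (y :: v) is Some k
                                then if k is _.+1 then y.+1 else y else y) 0 in
      if ev t X f (y :: v) is Some k then if k is _.+1 then None else Some y else None
  end.

Lemma computable_behead O {S T} {eS : Enc S} {eT : Enc T} (s : S -> seq T) :
  computable O s -> computable O (fun x => behead (s x)).
Proof.
move=> Hs; apply: (computable_ext (f := fun x => if s x is _ :: r then r else [::])) => //.
by computability.
Qed.

Lemma computable_ev O e {S} {eS : Enc S} (t : S -> nat) (X : S -> seq bool) (v : S -> seq nat) :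
  computable O t -> computable O X -> computable O v ->
  computable O (fun x => ev (t x) (X x) e (v x)).
Proof.
elim/program_nested_ind: e S eS t X v => [||i|| f gs IHf IHgs|f g IHf IHg|f IHf] S eS t X v Ht
  HX Hv;
  rewrite /=; try by computability.
- apply: computable_case_option; [| |by apply: IHf; computability]; last by computability.
  elim: gs IHgs => [_|g gs IH /= [IHg IHgs]] /=; first by computability.
  apply: computable_case_option; [exact: IHg | by computability | ].
  apply: computable_case_option; [ | by computability | by computability].
  by apply: (computable_comp (IH IHgs)); computability.
- apply: computable_iteri.
  + apply: (computable_ext (f := fun x => nth 0 (v x) 0)); first by move=> x; rewrite nth0.
    by computability.
  + by apply: IHf => //; exact: computable_behead.
  + computability; apply: IHg; computability.
    by apply: computable_behead; computability.
- have Hy : computable O (fun x => iter (t x) (fun y => if ev (t x) (X x) f (y :: v x) is Some k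
                                then if k is _.+1 then y.+1 else y else y) 0).
    by computability; apply: IHf; computability.
  by computability; apply: IHf; computability.
Qed.

Lemma ev_sound A t n e v y : ev t (mkseq A n) e v = Some y -> computes A e v y.
Proof.
elim/program_nested_ind: e v y => [||i|| f gs IHf IHgs|f g IHf IHg|f IHf] v y.
- by case.
- by case.
- by case.
- by rewrite /= size_mkseq; case: ltnP => // lt_n [<-]; rewrite nth_mkseq.
- rewrite [ev _ _ _ _]/= computes_compE.
  case E: (foldr _ _ _) => [ws|//] /IHf Hf; exists ws => //.
  elim: gs IHgs ws E {Hf} => [|g gs IH] /= IHgs ws; first by case=> <-.
  case Eg: (ev _ _ _ _) => [w|//].
  case: (foldr _ _ _) (IH IHgs.2) => [ws'|//] /(_ _ erefl) Hws' [<-].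
  by split=> //; exact: IHgs.1.
- rewrite [ev _ _ _ _]/= computes_precE.
  elim: (head 0 v) y => [|m IH] y /=; first exact: IHf.
  by case: (iteri _ _ _) IH => [z|//] /(_ z erefl) Hz /IHg; exists z.
- rewrite /=.
  (* The counter has passed m only because a positive value was found there. *)
  set F := (fun y => _); have HF : forall k m, m < iter k F 0 -> exists z, computes A f (m ::
    v) z.+1.
    elim=> [//|k IH] m; rewrite iterS {1}/F.
    case E: (ev _ _ _ _) => [[|z]|]; [exact: IH| |exact: IH].
    by rewrite ltnS leq_eqVlt => /predU1P[->|/IH //]; exists z; exact: IHf.
  case E: (ev _ _ _ _) => [[|//]|//] [<-]; split; [exact: IHf | exact: HF].
Qed.

(** The bound is required to work for all larger [t] and [n], so that the bounds of subcomputations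
    combine by maxima. *)
Lemma ev_complete A e v y : computes A e v y ->
  exists N, forall t n, N <= t -> N <= n -> ev t (mkseq A n) e v = Some y.
Proof.
elim/program_nested_ind: e v y => [||i|| f gs IHf IHgs|f g IHf IHg|f IHf] v y.
- by move=> ->; exists 0.
- by move=> ->; exists 0.
- by move=> ->; exists 0.
- move=> ->; exists (nth 0 v 0).+1 => t n _ lt_n.
  by rewrite /= size_mkseq lt_n nth_mkseq.
- rewrite computes_compE => -[ws Hws /IHf [N HN]].
  have [M HM] : exists M, forall t n, M <= t -> M <= n ->
      foldr (fun g r =>
           if ev t (mkseq A n) g v is Some w then if r is Some ws then Some (w :: ws) else None
           else None) (Some [::]) gs = Some ws.
    elim: gs IHgs ws Hws {HN} => [|g gs IH] /= IHgs [|w ws] //; first by exists 0.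
    move=> [/IHgs.1 [M1 H1] /(IH IHgs.2) [M2 H2]]; exists (maxn M1 M2) => t n.
    by rewrite !geq_max => /andP[? ?] /andP[? ?]; rewrite H1 // H2.
  exists (maxn M N) => t n; rewrite !geq_max => /andP[? ?] /andP[? ?].
  by rewrite [ev _ _ _ _]/= HM // HN.
- rewrite computes_precE /=; elim: (head 0 v) y => [|m IH] y /=; first exact: IHf.
  move=> [r /IH [M1 H1] /IHg [M2 H2]]; exists (maxn M1 M2) => t n.
  by rewrite !geq_max => /andP[? ?] /andP[? ?]; rewrite H1 // H2.
- move=> /= [/IHf [N HN] Hlt].
  have [M HM] : exists M, forall m, m < y -> forall t n, M <= t -> M <= n ->
      exists k, ev t (mkseq A n) f (m :: v) = Some k.+1.
    elim: y Hlt {HN} => [|y IH] Hlt; first by exists 0.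
    have [M1 H1] := IH (fun m lt_m => Hlt m (ltnW lt_m)).
    have [k /IHf [M2 H2]] := Hlt y (ltnSn y).
    exists (maxn M1 M2) => m; rewrite ltnS leq_eqVlt => /predU1P[->|lt_m] t n;
      rewrite !geq_max => /andP[? ?] /andP[? ?]; last exact: H1.
    by exists k; exact: H2.
  exists (maxn y (maxn M N)) => t n; rewrite !geq_max => /and3P[le_y ? ?] /and3P[_ ? ?].
  set F := (fun y => _); suff -> : iter t F 0 = y by rewrite HN.
  have Fy : F y = y by rewrite /F HN.
  (* The counter climbs to y in y rounds and stays there, y being a fixed point of [F]. *)
  rewrite -(subnK le_y) iterD; have -> : iter y F 0 = y.
    suff: forall k, k <= y -> iter k F 0 = k by apply.
    elim=> [//|k IH] lt_k; rewrite iterS (IH (ltnW lt_k)) {1}/F.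
    by have [z ->] := HM k lt_k t n (ltac:(assumption)) (ltac:(assumption)).
  by elim: (t - y) => //= k ->.
Qed.

(** Both computations are reproduced by the function [ev] at a common stage. *)
Lemma computes_functional A e v y z : computes A e v y -> computes A e v z -> y = z.
Proof.
move=> /ev_complete [N HN] /ev_complete [M HM].
have := HN (maxn N M) (maxn N M) (leq_maxl _ _) (leq_maxl _ _).
by rewrite HM ?leq_maxr // => -[].
Qed.

Lemma computes_comp1E A f g v y : computes A (Comp f [:: g]) v y ->
  exists2 w, computes A g v w & computes A f [:: w] y.
Proof.
rewrite computes_compE => -[ws].
by case: ws => [|w [|? ?]] [] // Hw _ Hy; exists w.
Qed.

Lemma computes_comp2E A f g h v y : computes A (Comp f [:: g; h]) v y ->
  exists w z, [/\ computes A g v w, computes A h v z & computes A f [:: w; z] y].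
Proof.
rewrite computes_compE => -[ws].
by case: ws => [|w [|z [|? ?]]] [] // Hw [] // Hz _ Hy; exists w, z.
Qed.

(** * Machines found by unbounded search *)

(** The machine looks for the least s at which [F] answers. Which s this is remains unspecified; the
    applications show that all answers for one input agree. *)
Lemma search_machine (O : (nat -> bool) -> Prop) (F : nat -> nat -> option nat) :
  computable O (fun p : nat * nat => F p.1 p.2) ->
  exists M, forall A x, O A ->
    (forall y, computes A M [:: x] y -> exists s, F s x = Some y) /\
    (forall s, F s x -> exists y, computes A M [:: x] y).
Proof.
move=> HF.
have [et Ht] : computable O (fun p : nat * nat => if F p.1 p.2 is Some _ then 0 else 1).
  by computability.
have [eo Ho] : computable O (fun p : nat * nat => if F p.1 p.2 is Some y then y else 0).
  by computability.
pose test := Comp et [:: pair_prog].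
have Htest A s x : O A -> computes A test [:: s; x] (if F s x is Some _ then 0 else 1).
  by move=> OA; exact: computes_comp1 (computes_pair _ _ _) (Ht A (s, x) OA).
pose out := Comp pair_prog [:: Mu test; Proj 0].
have Hout A s x : computes A (Mu test) [:: x] s -> computes A out [:: x] (pair_nat s x).
  by move=> Hs; apply: computes_comp2 Hs _ (computes_pair _ _ _).
exists (Comp eo [:: out]) => A x OA; split=> [y|s0 Fs0].
  case/computes_comp1E=> w /computes_comp2E [s [_ [Hs -> Hw]]] Hy; exists s.
  have [Hs0 _] := Hs; have := computes_functional (Htest A s x OA) Hs0.
  have := Ho A (s, x) OA; have -> : enc (s, x) = w.
    exact: computes_functional (computes_pair A s x) Hw.
  by case: (F s x) => [u|//] /= /(computes_functional Hy) ->.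
have ex_s : exists s, F s x by exists s0.
case: (ex_minnP ex_s) => s Fs min_s; exists (if F s x is Some y then y else 0).
apply: computes_comp1 (Ho A (s, x) OA); apply: Hout; split.
  by have := Htest A s x OA; case: (F s x) Fs.
move=> m lt_m; exists 0; have := Htest A m x OA.
by case: (F m x) (min_s m) => // y /(_ isT); rewrite leqNgt lt_m.
Qed.

(** * The Kraft-Chaitin theorem *)

Definition wt (n : nat) : rat := (2^-1 ^+ n)%R.

Lemma wt_gt0 n : (0 < wt n)%R.
Proof. by rewrite exprn_gt0. Qed.

Lemma wt_ge0 n : (0 <= wt n)%R.
Proof. exact/ltW/wt_gt0. Qed.

Lemma wtD m n : wt (m + n) = (wt m * wt n)%R.
Proof. exact: exprD. Qed.

Lemma wtS n : (wt n = wt n.+1 + wt n.+1)%R.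
Proof. by rewrite /wt exprS; field. Qed.

Lemma wt0 : wt 0 = 1%R.
Proof. exact: expr0. Qed.

Lemma wtK n : ((2 ^ n)%:R * wt n = 1)%R.
Proof. by rewrite natrX -exprMn divff ?expr1n. Qed.

Lemma leq_wt m n : m <= n -> (wt n <= wt m)%R.
Proof. by move=> le_mn; rewrite /wt ler_iXn2l. Qed.

(* [(S, D)] stands for the dyadic rational [S / 2 ^ D]. *)
Definition dyadic_sum (s : seq nat) : nat * nat :=
  foldr (fun n p => (p.1 * 2 ^ n + 2 ^ p.2, p.2 + n)) (0, 0) s.

Lemma dyadic_sumE s :
  ((dyadic_sum s).1%:R * wt (dyadic_sum s).2 = \sum_(n <- s) wt n)%R.
Proof.
elim: s => [|n s IH]; first by rewrite big_nil mul0r.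
rewrite big_cons -IH [dyadic_sum _]/= /= natrD natrM wtD.
have := wtK n; have := wtK (dyadic_sum s).2.
move: (2 ^ n)%:R%R (2 ^ _)%:R%R (wt _) (wt _) => a b c d bc ad; ring: bc ad.
Qed.

(** Unlike in [strnum], the head is the most significant bit, so that extending a string means
    halving a dyadic interval. *)
Definition msb (s : seq bool) : nat := foldl (fun n (b : bool) => n + n + b) 0 s.

(** The left end of the dyadic interval of the reals that extend s; its length is [wt (size s)]. *)
Definition binary_lo (s : seq bool) : rat := ((msb s)%:R * wt (size s))%R.

Lemma msb_rcons s b : msb (rcons s b) = msb s + msb s + b.
Proof. by rewrite /msb foldl_rcons. Qed.

Lemma msb_onto n v : v < 2 ^ n -> exists2 s, size s = n & msb s = v.
Proof.
elim: n v => [|n IH] v; first by rewrite expn0 ltnS leqn0 => /eqP ->; exists [::].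
rewrite expnS => lt_v; have [|s sz_s msb_s] := IH v./2; first by lia.
exists (rcons s (odd v)); first by rewrite size_rcons sz_s.
by rewrite msb_rcons msb_s; have := odd_double_half v; lia.
Qed.

(** Appending a bit passes to the left or right half of the interval, so extensions give
    subintervals. *)
Lemma binary_lo_prefix s t : prefix s t ->
  (binary_lo s <= binary_lo t)%R /\
  (binary_lo t + wt (size t) <= binary_lo s + wt (size s))%R.
Proof.
move=> /prefixP [r ->]; elim/last_ind: r => [|r b [IH1 IH2]]; first by rewrite cats0.
move: IH1 IH2; rewrite -rcons_cat /binary_lo msb_rcons size_rcons.
rewrite (wtS (size (s ++ r))) !natrD.
have := wt_gt0 (size (s ++ r)).+1; move: (wt _.+1) => w w_gt0.
have : (0 <= (b%:R : rat) <= 1)%R by case: b.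
case/andP; move: (b%:R)%R ((msb _)%:R)%R => c m c_ge0 c_le1.
have := mulr_ge0 c_ge0 (ltW w_gt0).
have : (0 <= (1 - c) * w)%R by rewrite mulr_ge0 ?subr_ge0 // ltW.
lra.
Qed.

(* The request [n] issued after the requests [s] owns the interval of length
   [wt n] that starts at their sum; the string that answers it is the first
   dyadic interval of length [wt n.+1] starting inside it. *)
Definition answers (s : seq nat) (n : nat) (t : seq bool) : bool :=
  [&& size t == n.+1, (dyadic_sum s).1 * 2 ^ n.+1 <= msb t * 2 ^ (dyadic_sum s).2
    & msb t * 2 ^ (dyadic_sum s).2 < (dyadic_sum s).1 * 2 ^ n.+1 + 2 ^ (dyadic_sum s).2].

Lemma answersP s n t : answers s n t ->
  [/\ size t = n.+1, (\sum_(m <- s) wt m <= binary_lo t)%R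
    & (binary_lo t + wt n.+1 <= \sum_(m <- s) wt m + wt n)%R].
Proof.
case/and3P=> /eqP sz_t lo hi; rewrite -dyadic_sumE /binary_lo sz_t.
have := wt_gt0 n.+1; have := wt_gt0 (dyadic_sum s).2.
have := wtK n.+1; have := wtK (dyadic_sum s).2; rewrite (wtS n).
move: lo hi; rewrite -(ler_nat rat) -(ltr_nat rat) natrD !natrM.
move: (2 ^ n.+1)%:R%R (2 ^ (dyadic_sum s).2)%:R%R (wt n.+1) (wt (dyadic_sum s).2) => a b c d.
move: (msb t)%:R%R (dyadic_sum s).1%:R%R => m S lo hi bd ac d_gt0 c_gt0.
have dc_gt0 : (0 < d * c)%R by rewrite mulr_gt0.
move: lo hi; rewrite -(ler_pM2r dc_gt0) -(ltr_pM2r dc_gt0).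
have -> : (S * a * (d * c) = S * d)%R by ring: ac.
have -> : (m * b * (d * c) = m * c)%R by ring: bd.
have -> : ((S * a + b) * (d * c) = S * d + c)%R by ring: ac bd.
by move=> lo hi; split=> //; lra.
Qed.

Lemma answers_onto s n : (\sum_(m <- s) wt m + wt n <= 1)%R ->
  exists t, answers s n t.
Proof.
rewrite -dyadic_sumE /answers; move: (dyadic_sum s) => -[S D] /= H.
have le_S : S * 2 ^ n + 2 ^ D <= 2 ^ D * 2 ^ n.
  move: H; have := wtK n; have := wtK D; have := wt_gt0 n; have := wt_gt0 D.
  rewrite -(ler_nat rat) natrD !natrM.
  move: (2 ^ n)%:R%R (2 ^ D)%:R%R (wt n) (wt D) (S%:R)%R => a b c d e.
  move=> d_gt0 c_gt0 bc ad H.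
  have cd_gt0 : (0 < c * d)%R by rewrite mulr_gt0.
  rewrite -(ler_pM2r cd_gt0); have -> : (b * a * (c * d) = 1)%R by ring: ad bc.
  by have -> : ((e * a + b) * (c * d) = e * d + c)%R by ring: ad bc.
(* The sum of the earlier requests, in units of [wt n.+1], rounded up. *)
pose v := (S * 2 ^ n.+1 + (2 ^ D).-1) %/ 2 ^ D.
have D_gt0 : 0 < 2 ^ D by rewrite expn_gt0.
have vE := divn_eq (S * 2 ^ n.+1 + (2 ^ D).-1) (2 ^ D); rewrite -/v in vE.
have mod_lt := ltn_pmod (S * 2 ^ n.+1 + (2 ^ D).-1) D_gt0.
have [|t sz_t msb_t] := @msb_onto n.+1 v.
  rewrite ltn_divLR // expnS mulnC.
  move: le_S D_gt0; move: (2 ^ n) (2 ^ D) => a b; nia.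
exists t; rewrite sz_t eqxx msb_t /=; lia.
Qed.

(** New requests are put at the head, so the tail of a list holds the requests issued before. The
    fold carries their lengths, which [answers] needs, next to the result found so far. *)
Definition lookup (t : seq bool) (L : seq (nat * nat)) : option nat :=
  (foldr (fun r p => (r.1 :: p.1, if answers p.1 r.1 t then Some r.2 else p.2))
     ([::], None) L).2.

Lemma lookup_cons t r L :
  lookup t (r :: L) = if answers [seq q.1 | q <- L] r.1 t then Some r.2 else lookup t L.
Proof.
rewrite /lookup /=; suff -> : forall p, (foldr (fun r p => (r.1 :: p.1, if answers p.1 r.1 t
  then Some r.2 else p.2))
     ([::], p) L).1 = [seq q.1 | q <- L] by [].
by move=> p; elim: L => //= q L ->.
Qed.

Lemma lookupP t L x : lookup t L = Some x ->
  exists L1 n L2, L = L1 ++ (n, x) :: L2 /\ answers [seq q.1 | q <- L2] n t.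
Proof.
elim: L => [//|[n y] L IH]; rewrite lookup_cons; case: ifP => [ans [<-]|_ /IH].
  by exists [::], n, L.
by move=> [L1 [m [L2 [-> ans]]]]; exists ((n, y) :: L1), m, L2.
Qed.

Lemma lookup_isSome t L1 n x L2 :
  answers [seq q.1 | q <- L2] n t -> lookup t (L1 ++ (n, x) :: L2).
Proof.
move=> ans; elim: L1 => [|r L1 IH] /=; rewrite lookup_cons /= ?ans //.
by case: ifP.
Qed.

Lemma sum_wt_cat L1 L2 :
  (\sum_(m <- [seq q.1 | q <- L1 ++ L2]) wt m =
   \sum_(m <- [seq q.1 : nat | q : nat * nat <- L1]) wt m + \sum_(m <- [seq q.1 : nat | q : nat
     * nat <- L2]) wt m)%R.
Proof. by rewrite map_cat big_cat. Qed.

Lemma sum_wt_ge0 s : (0 <= \sum_(m <- s) wt m)%R.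
Proof. by rewrite sumr_ge0 // => *; exact: wt_ge0. Qed.

(** A prefix has a larger interval, whereas different requests own disjoint intervals; so both
    strings answer the same request. *)
Lemma answers_prefix_free (L L1 L1' L2 L2' : seq (nat * nat)) n x n' x' t t' :
  L = L1 ++ (n, x) :: L2 -> L = L1' ++ (n', x') :: L2' ->
  answers [seq q.1 | q <- L2] n t -> answers [seq q.1 | q <- L2'] n' t' ->
  prefix t t' -> t = t' /\ x = x'.
Proof.
move=> E E' /answersP [sz_t lo hi] /answersP [sz_t' lo' hi'] pre.
have [le1 le2] := binary_lo_prefix pre.
(* The shorter suffix belongs to the earlier request, whose interval ends where the next one begins
   or before. *)
have key : forall M1 M2 (m y : nat) N1 N2, M1 ++ (m, y) :: N1 = M2 ++ N2 -> size N1 < size N2 ->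
    (\sum_(k <- [seq q.1 | q <- N1]) wt k + wt m <= \sum_(k <- [seq q.1 : nat | q : nat * nat
      <- N2]) wt k)%R.
  move=> M1 M2 m y N1 N2 EN lt_N.
  have : drop (size M2) (M1 ++ (m, y) :: N1) = N2 by rewrite EN drop_size_cat.
  have le_M : size M2 <= size M1.
    by have := congr1 size EN; rewrite !size_cat /=; lia.
  rewrite drop_cat; case: ltnP => [_|ge_M].
    move=> <-; rewrite sum_wt_cat /= big_cons.
    by have := sum_wt_ge0 [seq q.1 | q <- drop (size M2) M1]; lra.
  have -> : size M2 - size M1 = 0 by lia.
  by rewrite drop0 => <-; rewrite /= big_cons; lra.
rewrite sz_t sz_t' in le2.
have w_gt0 := wt_gt0 n.+1; have w'_gt0 := wt_gt0 n'.+1.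
have E2 : L1 ++ (n, x) :: L2 = L1' ++ (n', x') :: L2' by rewrite -E.
case: (ssrnat.ltngtP (size L2) (size L2')) => sz.
- by exfalso; have := key L1 (L1' ++ [:: (n', x')]) n x L2 L2'; rewrite -catA => /(_ E2 sz); lra.
- by exfalso; have := key L1' (L1 ++ [:: (n, x)]) n' x' L2' L2;
  rewrite -catA => /(_ (esym E2) sz); lra.
(* The same position means the same request, and then t and t' have the same length. *)
have szL1 : size L1 = size L1' by have := congr1 size E2; rewrite !size_cat /=; lia.
move/eqP: E2; rewrite eqseq_cat // => /andP[_ /eqP[En -> _]].
split=> //; move: pre; rewrite prefixE sz_t En -sz_t'.
by rewrite take_size eq_sym => /eqP.
Qed.

Lemma computable_answers O {S} {eS : Enc S} (s : S -> seq nat) n t :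
  computable O s -> computable O n -> computable O t ->
  computable O (fun x => answers (s x) (n x) (t x)).
Proof.
move=> Hs Hn Ht; rewrite /answers.
have Hd : computable O (fun x => dyadic_sum (s x)) by rewrite /dyadic_sum; computability.
have Hm : computable O (fun x => msb (t x)) by rewrite /msb; computability.
by computability.
Qed.

Lemma computable_lookup O {S} {eS : Enc S} t (L : S -> seq (nat * nat)) :
  computable O t -> computable O L -> computable O (fun x => lookup (t x) (L x)).
Proof.
by move=> Ht HL; rewrite /lookup; computability; apply: computable_answers; computability.
Qed.

Lemma growing_suffix T (L : nat -> seq T) : (forall s, exists l, L s.+1 = l ++ L s) ->
  forall s s', s <= s' -> exists l, L s' = l ++ L s.
Proof.
move=> Lgrow s s' /subnKC <-; elim: (s' - s) => [|k [l IH]]; first by exists [::]; rewrite addn0.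
by have [l' El'] := Lgrow (s + k); exists (l' ++ l); rewrite addnS El' IH catA.
Qed.

(** Descriptions are one bit longer than requested: an interval of length [wt n] may start anywhere,
    but always contains a dyadic interval of half its length. The enumeration works with every
    oracle, so the machine behaves the same for all of them. *)
Theorem kraft_chaitin (L : nat -> seq (nat * nat)) :
  computable xpredT L -> (forall s, exists l, L s.+1 = l ++ L s) ->
  (forall s, \sum_(r <- L s) wt r.1 <= 1)%R ->
  exists2 M, prefix_free_machine M &
    forall A s n x, (n, x) \in L s ->
      exists2 t, size t = n.+1 & describes M A t (numstr x).
Proof.
move=> HL Lgrow Lsum.
have [M HM] := @search_machine xpredT (fun s x => lookup (numstr x) (L s))
  ltac:(by apply: computable_lookup; [apply: computable_numstr|]; computability).
(* The two searches may succeed at different stages; both lists are suffixes of the list of the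
   later stage, where the requests can be compared. *)
have uniq_answer A t t' x x' : computes A M [:: strnum t] x ->
    computes A M [:: strnum t'] x' -> prefix t t' -> t = t' /\ x = x'.
  move=> /(HM A (strnum t) isT).1[s]; rewrite strnumK => /lookupP [L1 [n [L2 [Es ans]]]].
  move=> /(HM A (strnum t') isT).1[s']; rewrite strnumK => /lookupP [L1' [n' [L2' [Es' ans']]]].
  have [l El] := growing_suffix Lgrow (leq_maxl s s').
  have [l' El'] := growing_suffix Lgrow (leq_maxr s s').
  rewrite Es catA in El; rewrite Es' catA in El'.
  exact: answers_prefix_free El El' ans ans'.
exists M => [A t t' y y' Ht Ht' pre|A s n x].
  by have [] := uniq_answer A t t' _ _ Ht Ht' pre.
move=> r_in; have [L1 [L2 EL]] : exists L1 L2, L s = L1 ++ (n, x) :: L2.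
  by case/splitPr: r_in => L1 L2; exists L1, L2.
have [t ans] : exists t, answers [seq q.1 | q <- L2] n t.
  apply: answers_onto; have := Lsum s; rewrite EL big_cat big_cons /= big_map.
  have : (0 <= \sum_(r <- L1) wt r.1)%R by rewrite sumr_ge0 // => *; exact: wt_ge0.
  lra.
have [|y Hy] := (HM A (strnum t) isT).2 s; first by rewrite strnumK EL; exact: lookup_isSome.
have [s' ] := (HM A (strnum t) isT).1 y Hy; rewrite strnumK => /lookupP [L1' [n' [L2' [Es' ans']]]].
have [l El] := growing_suffix Lgrow (leq_maxl s s').
have [l' El'] := growing_suffix Lgrow (leq_maxr s s').
rewrite EL catA in El; rewrite Es' catA in El'.
have [_ Ex] := answers_prefix_free El El' ans ans' (prefix_refl t).
by exists t; [case/and3P: ans => /eqP | rewrite /describes numstrK Ex].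
Qed.

(** * Shortest descriptions and the Kraft inequality *)

Lemma K_rel_le U A tau sigma : describes U A tau sigma -> K_rel U A sigma <= size tau.
Proof.
move=> Htau; have has_tau : has_description U A sigma (size tau).
  by apply/asboolP; exists tau.
rewrite /K_rel; case: pselect => [h|[]]; last by exists (size tau).
by case: ex_minnP => n _; apply.
Qed.

Lemma K_rel_attained U A sigma : (exists tau, describes U A tau sigma) ->
  exists2 tau, describes U A tau sigma & size tau = K_rel U A sigma.
Proof.
move=> [tau Htau]; rewrite /K_rel; case: pselect => [h|[]]; last first.
  by exists (size tau); apply/asboolP; exists tau.
by case: ex_minnP => n /asboolP[t ? ?] _; exists t.
Qed.

(** Universality is applied to the Kraft-Chaitin machine for requests of length k + 1 for the string
    number k; their weights sum to less than 1. *)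
Lemma universal_describes U A sigma : universal_machine U ->
  exists tau, describes U A tau sigma.
Proof.
move=> [_ univ]; pose L s := iteri s (fun k r => (k.+1, k) :: r) [::].
have [|s|s|M Mpf HM] := @kraft_chaitin L; first by rewrite /L; computability.
- by exists [:: (s.+1, s)].
- suff -> : (\sum_(r <- L s) wt r.1 = 1 - wt s)%R by have := wt_ge0 s; lra.
  elim: s => [|s IH]; first by rewrite big_nil wt0 subrr.
  by rewrite /L /= big_cons IH; have /= := wtS s; lra.
have [t _ Ht] := HM A (strnum sigma).+1 _ _ (mem_head _ _).
have [d Hd] := univ M Mpf; have [t' Ht' _] := Hd A t _ Ht.
by exists t'; rewrite -[sigma]strnumK.
Qed.

(** Induction on the maximal length: a prefix-free list with the empty string has no other member,
    and any other list splits by the first bit into two lists of half the scale. *)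
Lemma kraft_inequality (C : seq (seq bool)) :
  pairwise (fun s t => ~~ prefix s t && ~~ prefix t s) C ->
  (\sum_(c <- C) wt (size c) <= 1)%R.
Proof.
have [N] : exists N, all (fun c => size c <= N) C.
  exists (\max_(c <- C) size c); apply/allP => c c_in.
  exact: (@leq_bigmax_seq _ C xpredT size).
elim: N C => [|N IH] C szC pfC.
  case: C szC pfC => [|c [|d C]] /=; first by rewrite big_nil.
    by rewrite big_seq1 andbT leqn0 => /eqP -> _; rewrite wt0.
  by case: c => //= /andP[]; rewrite prefix0s.
case: (boolP ([::] \in C)) => [nil_in|nil_notin].
  case/splitPr: nil_in pfC {szC} => C1 C2; rewrite pairwise_cat /= => /and4P[C1nil _ C2nil _].
  have -> : C2 = [::] by case: C2 C2nil {C1nil} => //= c C2; rewrite prefix0s.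
  have -> : C1 = [::] by case: C1 C1nil => //= c C1; rewrite allrel_consl /= prefix0s andbF.
  by rewrite big_seq1 wt0.
(* The empty string is excluded here, so the default of [head] never counts. *)
pose half b := [seq behead c | c <- C & head false c == b].
have half_le b : (\sum_(c <- half b) wt (size c) <= 1)%R.
  apply: IH.
    apply/allP => _ /mapP[c + ->]; rewrite mem_filter => /andP[_ c_in].
    by have := allP szC _ c_in; rewrite size_behead; lia.
  rewrite pairwise_map; have := pairwise_filter [pred c | head false c == b] pfC.
  apply: sub_in_pairwise (allss _) => c d; rewrite !mem_filter /=.
  case: c => [|? c]; first by rewrite (negPf nil_notin) andbF.
  case: d => [|? d]; first by rewrite (negPf nil_notin) andbF.
  by rewrite /= => /andP[/eqP -> _] /andP[/eqP -> _]; rewrite eqxx.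
have -> : (\sum_(c <- C) wt (size c) =
    2^-1 * \sum_(c <- half true) wt (size c) + 2^-1 * \sum_(c <- half false) wt (size c))%R.
  rewrite /half; elim: C nil_notin {szC pfC half half_le} => [|[|b c] C IHC] //=.
    by rewrite !big_nil mulr0 addr0.
  rewrite inE /= => /IHC E; rewrite big_cons E /wt /= exprS.
  by case: b => /=; rewrite big_cons mulrDr; ring.
have := half_le true; have := half_le false; lra.
Qed.

(** * Templates *)

(* [None] marks a free position; all the positions beyond the end are free. *)
Definition template := seq (option bool).

Definition undecided (p : template) n := ~~ isSome (nth None p n).

(** The binary logarithm of the number of live strings of length x. *)
Definition level (p : template) x := count (undecided p) (iota 0 x).

Definition compatible (p : template) (A : nat -> bool) x :=
  all (fun n => if nth None p n is Some b then A n == b else true) (iota 0 x).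

Definition branch (p : template) (A : nat -> bool) := forall x, compatible p A x.

Definition initial_segment (Y : seq bool) (A : nat -> bool) :=
  all (fun n => nth false Y n == A n) (iota 0 (size Y)).

Definition live p (X : seq bool) := compatible p (nth false X) (size X).

(** On positions that p has fixed already, a live X has the same value, so writing X there changes
    nothing. *)
Definition freeze (p : template) (X : seq bool) i : template :=
  [seq (if undecided p n && (level p n < i) then None else Some (nth false X n))
     | n <- iota 0 (size X)].

Lemma compatibleP p A x :
  reflect (forall n b, n < x -> nth None p n = Some b -> A n = b) (compatible p A x).
Proof.
apply: (iffP allP) => [H n b lt_n E|H n].
  by have := H n; rewrite mem_iota lt_n E => /(_ isT)/eqP.
by rewrite mem_iota => /= /H; case: (nth _ _ _) => // b /(_ b erefl) ->.
Qed.

Lemma initial_segmentP Y A :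
  reflect (forall n, n < size Y -> nth false Y n = A n) (initial_segment Y A).
Proof.
apply: (iffP allP) => [H n lt_n|H n]; first by have := H n; rewrite mem_iota => /(_ lt_n)/eqP.
by rewrite mem_iota => /= /H ->.
Qed.

Lemma initial_segment_mkseq Y A : initial_segment Y A = (Y == mkseq A (size Y)).
Proof.
apply/initial_segmentP/eqP => [H|E n lt_n].
  apply: (@eq_from_nth _ false) => [|n lt_n]; first by rewrite size_mkseq.
  by rewrite nth_mkseq // H.
by rewrite E nth_mkseq.
Qed.

Lemma branchP p A : branch p A <-> forall n b, nth None p n = Some b -> A n = b.
Proof.
split=> [H n b|H x]; first exact: (compatibleP _ _ _ (H n.+1)).
by apply/compatibleP => n b _; exact: H.
Qed.

Lemma levelS p x : level p x.+1 = level p x + undecided p x.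
Proof. by rewrite /level -addn1 iotaD count_cat /= addn0. Qed.

Lemma level_le p x : level p x <= x.
Proof. by rewrite /level (leq_trans (count_size _ _)) ?size_iota. Qed.

Lemma leq_level p x y : x <= y -> level p x <= level p y.
Proof. by move=> /subnKC <-; rewrite /level iotaD count_cat leq_addr. Qed.

Lemma level_lt p x y : undecided p x -> x < y -> level p x < level p y.
Proof. by move=> fx /(leq_level p); rewrite levelS fx addn1. Qed.

Lemma level_inj p x y : undecided p x -> undecided p y -> level p x = level p y -> x = y.
Proof.
move=> fx fy E; case: (ssrnat.ltngtP x y) => // lt_xy.
  by have := level_lt fx lt_xy; rewrite E ltnn.
by have := level_lt fy lt_xy; rewrite E ltnn.
Qed.

Lemma nth_freeze p X i n : nth None (freeze p X i) n =
  if n < size X then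
    if undecided p n && (level p n < i) then None else Some (nth false X n)
  else None.
Proof.
case: ltnP => lt_n; last by rewrite nth_default // size_map size_iota.
by rewrite (nth_map 0) ?size_iota // nth_iota.
Qed.

Section Freeze.
Variables (p : template) (X : seq bool) (i : nat).
Hypotheses (sz_p : size p <= size X) (live_X : live p X).
Let p' := freeze p X i.

(** Exactly the first i free positions survive below the end of X. *)
Lemma level_freeze y : y <= size X -> level p' y = minn (level p y) i.
Proof.
elim: y => [|y IH] lt_y; first by rewrite /level min0n.
rewrite !levelS IH 1?ltnW // {1}/undecided nth_freeze lt_y.
case: (undecided p y) => /=; last by rewrite !addn0.
by case: (ltnP (level p y) i) => /=; lia.
Qed.

Lemma nth_freeze_old n b : nth None p n = Some b -> nth None p' n = Some b.
Proof.
move=> E; have lt_n : n < size X.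
  by case: (ltnP n (size p)) => [|ge_n]; [lia | rewrite nth_default in E].
by rewrite nth_freeze lt_n /undecided E /=; congr Some; exact: (compatibleP _ _ _ live_X).
Qed.

Lemma compatible_freeze A x : compatible p' A x -> compatible p A x.
Proof.
move=> /compatibleP H; apply/compatibleP => n b lt_n /nth_freeze_old.
exact: H.
Qed.

Lemma branch_freeze A : branch p' A -> branch p A.
Proof. by move=> H x; exact: compatible_freeze. Qed.

(** A newly fixed position has at least i free positions before it, hence does not lie below the end
    of Y. *)
Lemma live_freeze_low Y : size Y <= size X -> live p Y -> level p (size Y) <= i -> live p' Y.
Proof.
move=> le_Y /compatibleP lY lev; apply/compatibleP => n b lt_n.
rewrite nth_freeze (leq_trans lt_n) //; case: ifP => // + [<-].
case E: (nth None p n) => [c|]; rewrite /undecided E /= => fr.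
  by rewrite (lY _ _ lt_n E) (compatibleP _ _ _ live_X n c) // (leq_trans lt_n).
by have := @level_lt p n (size Y); rewrite /undecided E /= => /(_ isT lt_n); lia.
Qed.

Lemma live_freeze_segment Y : size Y <= size X -> initial_segment Y (nth false X) -> live p' Y.
Proof.
move=> le_Y /initial_segmentP sY; apply/compatibleP => n b lt_n.
by rewrite nth_freeze (leq_trans lt_n) //; case: ifP => // _ [<-]; exact: sY.
Qed.
End Freeze.

(** * The construction *)

(* The record (sigma, (tau, (X, k))) is the request for a description of sigma
   of length [size tau + k], issued because U with oracle X maps tau to sigma. *)
Definition request : Type := nat * (seq bool * (seq bool * nat)).
Definition target (r : request) := r.1.
Definition source (r : request) := r.2.1.
Definition oracle_use (r : request) := r.2.2.1.
Definition discount (r : request) := r.2.2.2.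
Definition length_req (r : request) := size (source r) + discount r.

(* A history lists the actions so far: their level and whether they were forced. *)
Definition history := seq (nat * bool).

(** The bounds on the waste of level j multiply [wt (threshold H j)] by at most a constant times
    4^j, and [wt (tolerance H j)] by a constant times 2^j. The summands 3j and 2j leave a factor
    2^-j, which is summable. *)
Definition threshold (H : history) j := count (fun h => h.1 < j) H + 3 * j.
Definition tolerance (H : history) j := count (fun h => (h.1 == j) && h.2) H + 2 * j.

Definition beyond p (A : nat -> bool) j (r : request) :=
  (j < level p (size (oracle_use r))) && initial_segment (oracle_use r) A.

Definition gain_list p (R : seq request) A j :=
  [seq length_req r | r <- R & beyond p A j r].

(** The comparison of the weight beyond level j with [wt e] is made in natural numbers, because the
    construction has to be computable. *)
Definition large_gain p R A j e :=
  let d := dyadic_sum (gain_list p R A j) in 2 ^ d.2 <= d.1 * 2 ^ e.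

Definition wants p R (H : history) X k i :=
  (k < threshold H i) || large_gain p R (nth false X) i (tolerance H i).

(** The least level that wants to act; the value [level p (size X)] means that none does. *)
Definition action_level p R H X k :=
  find (wants p R H X k) (iota 0 (level p (size X))).

Definition state : Type := template * (seq request * history).

Definition issue (st : state) (r : request) : state :=
  let: (p, (R, H)) := st in
  let i := action_level p (r :: R) H (oracle_use r) (discount r) in
  if i < level p (size (oracle_use r)) then
    (freeze p (oracle_use r) i, (r :: R, (i, discount r < threshold H i) :: H))
  else (p, (r :: R, H)).

(** Only unsatisfied requests are issued, so each is shorter than the earlier ones for its target
    and the list stays [improving]. *)
Definition satisfied (R : seq request) sigma n :=
  has (fun r => (target r == sigma) && (length_req r <= n)) R.

(** The length of the oracle X also serves as the bound on searches and as the stage of the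
    approximation. *)
Definition process U fs (st : state) (X tau : seq bool) : state :=
  if ev (size X) X U [:: strnum tau] is Some sigma then
    let k := fs (size X) (numstr sigma) in
    if live st.1 X && ~~ satisfied st.2.1 sigma (size tau + k)
    then issue st (sigma, (tau, (X, k))) else st
  else st.

Definition stage U fs (st : state) X : state :=
  foldl (fun st m => process U fs st X (numstr m)) st (iota 0 (size X)).

(** Strings are treated in the order of [numstr], hence by nondecreasing length; so the template is
    never longer than the string at hand, as the lemmas on [freeze] require. *)
Definition run U fs n : state :=
  iteri n (fun n st => stage U fs st (numstr n)) ([::], ([::], [::])).

(** * Weights of sets of requests *)

Definition weight (Q : pred request) (R : seq request) : rat :=
  (\sum_(r <- R | Q r) wt (length_req r))%R.

Lemma weight_ge0 Q R : (0 <= weight Q R)%R.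
Proof. by rewrite sumr_ge0 // => *; exact: wt_ge0. Qed.

Lemma weight_cons Q r R :
  (weight Q (r :: R) = (if Q r then wt (length_req r) else 0) + weight Q R)%R.
Proof. by rewrite /weight big_cons; case: ifP => // _; rewrite add0r. Qed.

Lemma eq_in_weight Q Q' R : {in R, Q =1 Q'} -> weight Q R = weight Q' R.
Proof.
move=> H; rewrite /weight big_seq_cond [RHS]big_seq_cond; apply: eq_bigl => r.
by case: (boolP (r \in R)) => // /H ->.
Qed.

Lemma leq_in_weight (Q Q' : pred request) R :
  {in R, forall r, Q r -> Q' r} -> (weight Q R <= weight Q' R)%R.
Proof.
move=> H; rewrite /weight [leLHS]big_mkcond [leRHS]big_mkcond /= big_seq [leRHS]big_seq.
apply: ler_sum => r /H; case: (Q r) => [-> //|_].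
by case: (Q' r); rewrite ?wt_ge0.
Qed.

Lemma weight_split (S Q : pred request) R :
  (weight Q R = weight (fun r => Q r && S r) R + weight (fun r => Q r && ~~ S r) R)%R.
Proof. exact: bigID. Qed.

Lemma weight0 (Q : pred request) R : {in R, forall r, ~~ Q r} -> weight Q R = 0%R.
Proof.
by move=> H; rewrite (@eq_in_weight _ pred0) => [|r /H/negPf //]; rewrite /weight big_pred0.
Qed.

Lemma weight_le_levels (Q : pred request) (lev : request -> nat) i J R :
  {in R, forall r, Q r -> i < lev r <= J} ->
  (weight Q R <= \sum_(j < J) weight (fun r => Q r && (lev r == j.+1)) R)%R.
Proof.
move=> H; rewrite /weight /=; under [leRHS]eq_bigr => j _ do rewrite big_mkcondr /=.
rewrite exchange_big /= big_seq_cond [leRHS]big_seq_cond.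
apply: ler_sum => r /andP[r_in Qr]; have /andP[i_lt le_J] := H r r_in Qr.
have lt_J : (lev r).-1 < J by lia.
rewrite (bigD1 (Ordinal lt_J)) //= prednK ?eqxx; last by lia.
by rewrite lerDl sumr_ge0 // => j _; case: ifP => // _; exact: wt_ge0.
Qed.

Lemma large_gainE p R A j e : large_gain p R A j e = (wt e <= weight (beyond p A j) R)%R.
Proof.
have <- : (\sum_(n <- gain_list p R A j) wt n)%R = weight (beyond p A j) R.
  by rewrite big_map big_filter.
rewrite -dyadic_sumE /large_gain; move: (dyadic_sum _) => [S D] /=.
have := wtK D; have := wtK e; have := wt_gt0 D; have := wt_gt0 e.
rewrite -(ler_nat rat) natrM.
move: (2 ^ D)%:R%R (2 ^ e)%:R%R (wt D) (wt e) (S%:R)%R => a b c d s.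
move=> d_gt0 c_gt0 bd ac; have cd_gt0 : (0 < c * d)%R by rewrite mulr_gt0.
rewrite -[LHS](ler_pM2r cd_gt0).
have -> : (a * (c * d) = d)%R by ring: ac.
by have -> : (s * b * (c * d) = s * c)%R by ring: bd.
Qed.

(** * Requests along one branch *)

Lemma prefix_cat_comparable (s s' u u' : seq bool) :
  prefix (s ++ u) (s' ++ u') -> prefix s s' || prefix s' s.
Proof.
elim: s s' => [|a s IH] [|b s'] //=.
by case: eqP => //= -> /IH; rewrite eqxx.
Qed.

Lemma prefix_unary m n :
  prefix (nseq m true ++ [:: false]) (nseq n true ++ [:: false]) -> m = n.
Proof. by elim: m n => [|m IH] [|n] //= /IH ->. Qed.

Definition sound U (R : seq request) := forall r A, r \in R ->
  initial_segment (oracle_use r) A -> computes A U [:: strnum (source r)] (target r).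

Definition improving : seq request -> bool :=
  pairwise (fun r r' => (target r == target r') ==> (length_req r < length_req r')).

(* The requests below a branch A are weighed by the prefix-free codes
   source 1^(discount - d) 0: two requests with the same source have the same
   target, hence different discounts. *)
Lemma branch_weight U R A d : prefix_free_machine U -> sound U R -> improving R ->
  (weight (fun r => initial_segment (oracle_use r) A && (d <= discount r)%N) R <= 2 * wt d)%R.
Proof.
move=> pfU soundR impR; set Q := fun r => _.
pose code r := source r ++ nseq (discount r - d) true ++ [:: false].
(* A code is d bits shorter and one bit longer than its request, whence the factor. *)
have -> : weight Q R = (2 * wt d * \sum_(c <- [seq code r | r <- R & Q r]) wt (size c))%R.
  rewrite big_map big_filter mulr_sumr; apply: eq_bigr => r /andP[_ le_d].
  rewrite !size_cat size_nseq /= addn1 addnS.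
  have -> : length_req r = d + (size (source r) + (discount r - d)).
    by rewrite /length_req; lia.
  by rewrite wtD (wtS (_ + _)); ring.
rewrite -[leRHS]mulr1 ler_pM2l ?mulr_gt0 ?wt_gt0 //; apply: kraft_inequality.
rewrite pairwise_map; have := pairwise_filter Q impR.
have : all [pred r | (r \in R) && Q r] [seq r <- R | Q r].
  by apply/allP => r; rewrite mem_filter /= andbC.
apply: sub_in_pairwise => r r' /andP[r_in /andP[r_A r_d]] /andP[r'_in /andP[r'_A r'_d]] /= imp.
have comp := soundR r A r_in r_A; have comp' := soundR r' A r'_in r'_A.
have incomparable : source r = source r' -> discount r = discount r' -> False.
  move=> Es Ed; move: imp; rewrite /length_req Es Ed ltnn implybF => /eqP; apply.
  by rewrite Es in comp; exact: computes_functional comp comp'.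
have same_source : prefix (source r) (source r') || prefix (source r') (source r) -> source r =
  source r'.
  rewrite -(numstrK (target r)) in comp; rewrite -(numstrK (target r')) in comp'.
  by case/orP=> [/(pfU A _ _ _ _ comp comp')|/(pfU A _ _ _ _ comp' comp)].
apply/andP; split; apply/negP => pre; have := prefix_cat_comparable pre.
- move=> /same_source Es; apply: incomparable => //.
  move: pre; rewrite /code Es prefix_catr // eqxx => /prefix_unary; lia.
- rewrite orbC => /same_source Es; apply: incomparable => //.
  move: pre; rewrite /code Es prefix_catr // eqxx => /prefix_unary; lia.
Qed.

(* Every live string of level at most j lies on one of the 2^j branches obtained
   by filling the first j free positions arbitrarily and the others with 0. *)
Lemma live_weight p (Q : pred request) R j b :
  (forall A, branch p A -> (weight (fun r => Q r && initial_segment (oracle_use r) A) R <= b)%R) ->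
  (weight (fun r => [&& Q r, live p (oracle_use r) & (level p (size (oracle_use r)) <= j)%N]) R
    <= (2 ^ j)%:R * b)%R.
Proof.
move=> HA.
pose fill (a : j.-tuple bool) n :=
  if nth None p n is Some c then c else nth false a (level p n).
have fill_branch a : branch p (fill a) by apply/branchP => n c E; rewrite /fill E.
have -> : ((2 ^ j)%:R * b = \sum_(a : j.-tuple bool) b)%R.
  by rewrite sumr_const card_tuple card_bool mulr_natl.
apply: le_trans (ler_sum _ (fun a _ => HA _ (fill_branch a))).
rewrite /weight /=; under [leRHS]eq_bigr => a _ do rewrite big_mkcondr /=.
rewrite exchange_big /= [leLHS]big_mkcondr /=; apply: ler_sum => r _.
case: ifP => [/andP[/compatibleP lr le_j]|_]; last first.
  by rewrite sumr_ge0 // => a _; case: ifP => // _; exact: wt_ge0.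
set X := oracle_use r in lr le_j *.
(* [pos m] is the m-th free position. Reading X there gives the filling whose branch passes through
   X. *)
pose pos m := find (fun n => undecided p n && (level p n == m)) (iota 0 (size X)).
pose a := mktuple (fun m : 'I_j => nth false X (pos m)).
rewrite (bigD1 a) //= ifT ?lerDl ?sumr_ge0 // => [a' _|]; first by case: ifP => // _; exact: wt_ge0.
apply/initial_segmentP => n lt_n; rewrite /fill.
case E: (nth None p n) => [c|]; first by rewrite -/X (lr _ _ lt_n E).
have und_n : undecided p n by rewrite /undecided E.
have lt_j : level p n < j by apply: leq_trans (level_lt und_n lt_n) le_j.
rewrite -[level p n]/(nat_of_ord (Ordinal lt_j)) nth_mktuple /=; congr (nth _ _ _).
have has_n : has (fun m => undecided p m && (level p m == level p n)) (iota 0 (size X)).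
  by apply/hasP; exists n; rewrite ?mem_iota ?und_n ?eqxx.
have /andP[fp /eqP lev] := nth_find 0 has_n.
move: has_n; rewrite has_find size_iota => lt_pos.
by rewrite nth_iota // in fp lev; apply/esym; exact: level_inj fp und_n lev.
Qed.

(** * The invariant *)

(** Actions of level j or more keep these requests: they do not touch the first j free positions and
    leave [threshold H j] unchanged. *)
Definition captured p (H : history) j : pred request := fun r =>
  [&& threshold H j <= discount r, live p (oracle_use r)
    & level p (size (oracle_use r)) <= j].

Definition pow2 j : rat := ((2 ^ j)%:R)%R.

(* Nondecreasing in time: what [captured] loses when an action happens below
   level j is made up for by the increase of [threshold H j]. *)
Definition stored p R H j : rat :=
  (weight (captured p H j) R + 4 * pow2 j * (wt (3 * j) - wt (threshold H j)))%R.

(** Pays for the requests that had j + 1 free positions when they died. The first summand grows with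
    the actions below level j, the second with the forced actions of level j, the third with the
    unforced ones. *)
Definition budget p R H j : rat :=
  (8 * pow2 j * (wt (3 * j) - wt (threshold H j))
   + 4 * pow2 j * (wt (2 * j) - wt (tolerance H j))
   + 2 * pow2 j * stored p R H j)%R.

Definition forced (H : history) j := count (fun h => (h.1 == j) && h.2) H.
Definition unforced (H : history) j := count (fun h => (h.1 == j) && ~~ h.2) H.

Definition dead p : pred request := fun r => ~~ live p (oracle_use r).

(** [inv_gain] bounds what an action of level j can waste, [inv_discount] makes live requests of
    high level light, and [inv_dead] charges the waste to the budgets, for every J from [L] on so
    that it persists when [L] grows. The last two fields bound the number of actions: forced ones by
    requests of small discount, unforced ones by [stored]. *)
Record consistent U L p R H : Prop := {
  inv_template : size p <= L;
  inv_use : forall r, r \in R -> size (oracle_use r) <= L;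
  inv_sound : sound U R;
  inv_improving : improving R;
  inv_gain : forall A j, branch p A -> (weight (beyond p A j) R < wt (tolerance H j))%R;
  inv_discount : forall r j, r \in R -> live p (oracle_use r) ->
    j < level p (size (oracle_use r)) -> threshold H j <= discount r;
  inv_dead : forall J, L <= J -> (weight (dead p) R <= \sum_(j < J) budget p R H j)%R;
  inv_forced : forall j, forced H j <= count (fun r => discount r < threshold H j) R;
  inv_unforced : forall j, ((unforced H j)%:R * wt (tolerance H j) <= stored p R H j)%R
}.

Lemma pow2_gt0 j : (0 < pow2 j)%R.
Proof. by rewrite ltr0n expn_gt0. Qed.

Lemma captured_weight U p R H j : prefix_free_machine U -> sound U R -> improving R ->
  (weight (captured p H j) R <= 2 * pow2 j * wt (threshold H j))%R.
Proof.
move=> pfU soundR impR; rewrite [leRHS](_ : _ = (2 ^ j)%:R * (2 * wt (threshold H j)))%R.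
  apply: live_weight => A _; apply: le_trans (branch_weight A _ pfU soundR impR).
  by apply: leq_in_weight => r _ /andP[-> ->].
by rewrite /pow2; ring.
Qed.

Lemma leq_weight_cons Q r R : (weight Q R <= weight Q (r :: R))%R.
Proof. by rewrite weight_cons; case: ifP => _; have := wt_ge0 (length_req r); lra. Qed.

(** * Preservation of the invariant when one request is issued *)

Section Issue.
Variables (U : program) (L : nat) (p : template) (R : seq request) (H : history).
Variables (X : seq bool) (tau : seq bool) (sigma k : nat).
Hypothesis pfU : prefix_free_machine U.
Hypothesis inv : consistent U L p R H.
Hypothesis le_L : L <= size X.
Hypothesis live_X : live p X.
Hypothesis comp_X : forall A, initial_segment X A -> computes A U [:: strnum tau] sigma.
Hypothesis new_X : ~~ satisfied R sigma (size tau + k).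

Let r : request := (sigma, (tau, (X, k))).
Let R' := r :: R.
Let i0 := action_level p R' H X k.

Let use_le r1 : r1 \in R' -> size (oracle_use r1) <= size X.
Proof. by rewrite inE => /predU1P[->//|/(inv_use inv)]; lia. Qed.

Let sound_R' : sound U R'.
Proof. by move=> r1 A; rewrite inE => /predU1P[->|/(inv_sound inv)]; [exact: comp_X | apply]. Qed.

Let improving_R' : improving R'.
Proof.
rewrite /improving /= -/improving; apply/andP; split; last exact: (inv_improving inv).
apply/allP => r1 r1_in; apply/implyP => /= /eqP E.
rewrite ltnNge; apply: contra new_X => le_len; apply/hasP; exists r1 => //.
by rewrite -E eqxx.
Qed.

Let template_le : size p <= size X.
Proof. exact: leq_trans (inv_template inv) le_L. Qed.

Let not_wanted j : j < i0 -> j < level p (size X) ->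
  threshold H j <= k /\ (weight (beyond p (nth false X) j) R' < wt (tolerance H j))%R.
Proof.
move=> lt_j lt_lev; have := @before_find _ 0 (wants p R' H X k) _ _ lt_j.
rewrite nth_iota // add0n => /negbT; rewrite /wants negb_or -leqNgt => /andP[le_k].
by rewrite large_gainE -ltNge.
Qed.

(** Off X the new request does not count. A branch through X sees the same requests as X itself, for
    which level j did not want to act or which have at most j free positions. *)
Let gain_below A j : branch p A -> j < i0 \/ i0 >= level p (size X) ->
  (weight (beyond p A j) R' < wt (tolerance H j))%R.
Proof.
move=> pA Hj; case: (boolP (initial_segment X A)) => [sA|nsA]; last first.
  rewrite weight_cons /beyond /= (negPf nsA) andbF add0r; exact: (inv_gain inv).
have -> : weight (beyond p A j) R' = weight (beyond p (nth false X) j) R'.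
  apply: eq_in_weight => r1 /use_le le_X; congr (_ && _).
  apply/initial_segmentP/initial_segmentP => S n lt_n; have lt_X := leq_trans lt_n le_X.
    by rewrite S // (initial_segmentP _ _ sA).
  by rewrite S // (initial_segmentP _ _ sA).
case: (ltnP j (level p (size X))) => [lt_lev|ge_lev].
  by apply: (not_wanted _ lt_lev).2; case: Hj => //; exact: leq_trans.
rewrite weight0 ?wt_gt0 // => r1 /use_le le_X.
by rewrite /beyond negb_and -leqNgt (leq_trans (leq_level _ le_X)).
Qed.

Lemma issue_invariant_wait : level p (size X) <= i0 -> consistent U (size X) p R' H.
Proof.
move=> wait; have stored_le j : (stored p R H j <= stored p R' H j)%R.
  by rewrite /stored lerD2r leq_weight_cons.
split=> //.
- by move=> A j pA; apply: gain_below => //; right.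
- move=> r1 j; rewrite inE => /predU1P[->|r1_in]; last exact: (inv_discount inv).
  by move=> _ lt_j; apply: (not_wanted _ lt_j).1; exact: leq_trans wait.
- move=> J le_J; rewrite weight_cons /dead /= live_X /= add0r.
  apply: le_trans (inv_dead inv (leq_trans le_L le_J)) _.
  apply: ler_sum => j _; rewrite /budget lerD2l ler_pM2l //.
  by rewrite mulr_gt0 ?pow2_gt0.
- by move=> j; rewrite (leq_trans (inv_forced inv j)) //= leq_addl.
- by move=> j; exact: le_trans (inv_unforced inv j) (stored_le j).
Qed.

Section Act.
Hypothesis act : i0 < level p (size X).
Let b := k < threshold H i0.
Let p' := freeze p X i0.
Let H' := (i0, b) :: H.

Let thresholdE j : threshold H' j = (i0 < j) + threshold H j.
Proof. by rewrite /threshold /= addnA. Qed.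

Let threshold_le j : j <= i0 -> threshold H' j = threshold H j.
Proof. by rewrite thresholdE ltnNge => ->. Qed.

Let threshold_gt j : i0 < j -> threshold H' j = (threshold H j).+1.
Proof. by rewrite thresholdE => ->. Qed.

Let toleranceE j : tolerance H' j = ((i0 == j) && b) + tolerance H j.
Proof. by rewrite /tolerance /= addnA. Qed.

Let level_p' y : y <= size X -> level p' y = minn (level p y) i0.
Proof. exact: level_freeze. Qed.

Let live_old Y : live p' Y -> live p Y.
Proof. exact: compatible_freeze. Qed.

(** Strings with at most j free positions survive the action. The conjunct on the old level keeps
    them apart from the requests that the action captures anew. *)
Let captured_mono j : j <= i0 ->
  (weight (captured p H j) R <= weight (fun r => captured p' H' j r && (level p (size
    (oracle_use r)) <= i0)%N) R')%R.
Proof.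
move=> le_j; apply: le_trans (leq_weight_cons _ r _) _.
apply: leq_in_weight => r1 /use_le le_X /and3P[thr lv lev].
rewrite /= /captured threshold_le // thr level_p' // geq_min lev /=.
by rewrite (leq_trans lev le_j) live_freeze_low // (leq_trans lev le_j).
Qed.

Let stored_le j : (stored p R H j <= stored p' R' H' j)%R.
Proof.
rewrite /stored; case: (leqP j i0) => [le_j|lt_j].
  rewrite threshold_le // lerD2r (le_trans (captured_mono le_j)) //.
  by apply: leq_in_weight => r1 _ /andP[].
(* All captured requests may be lost; they weigh at most what the second summand gains when the
   threshold grows by one. *)
have := captured_weight p H j pfU (inv_sound inv) (inv_improving inv).
have := weight_ge0 (captured p' H' j) R'.
rewrite threshold_gt // (wtS (threshold H j)).
set w := wt _.+1; set c := weight _ _; set c' := weight _ _ => *.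
lra.
Qed.

(** The action is due to a large gain: the requests along X with more than [i0] free positions weigh
    at least the tolerance. After the action they have [i0] free positions and are captured, in
    addition to those captured before. *)
Let stored_unforced : ~~ b ->
  (stored p R H i0 + wt (tolerance H i0) <= stored p' R' H' i0)%R.
Proof.
move=> nb; rewrite /stored threshold_le // addrAC lerD2r.
have := captured_mono (leqnn i0).
have [_ ] : has (wants p R' H X k) (iota 0 (level p (size X))) /\ wants p R' H X k i0.
  have hasW : has (wants p R' H X k) (iota 0 (level p (size X))).
    by rewrite has_find size_iota.
  by split=> //; have := nth_find 0 hasW; rewrite nth_iota.
rewrite /wants -/b (negPf nb) /= large_gainE => gain cap.
rewrite [leRHS](weight_split (fun r => level p (size (oracle_use r)) <= i0)).
apply: lerD => //; apply: le_trans gain _.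
apply: leq_in_weight => r1 r1_in /andP[lt_lev seg]; have le_X := use_le r1_in.
have lv' : live p' (oracle_use r1) by exact: live_freeze_segment.
rewrite /= -ltnNge lt_lev andbT /captured threshold_le // lv' level_p' // geq_minr andbT.
move: r1_in lt_lev; rewrite inE => /predU1P[-> _|r1_in lt_lev]; first by rewrite andbT leqNgt;
  exact: nb.
by rewrite andbT; exact: (inv_discount inv r1_in (live_old lv')).
Qed.

(** A request with j + 1 free positions is killed only by an action of level at most j, hence the
    shift of the index. *)
Let killed j : pred request := fun r1 =>
  [&& live p (oracle_use r1) && ~~ live p' (oracle_use r1)
    & level p (size (oracle_use r1)) == j.+1].

Let killed_low r1 : r1 \in R -> live p (oracle_use r1) -> ~~ live p' (oracle_use r1) ->
  i0 < level p (size (oracle_use r1)).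
Proof.
move=> r1_in lv nlv; rewrite ltnNge; apply: contra nlv => lev.
by apply: live_freeze_low => //; apply: use_le; rewrite inE r1_in orbT.
Qed.

(** An action above level j kills nothing here, one below is paid by the threshold. One of level j
    is paid by the tolerance if it is forced, and by [stored] otherwise. *)
Let killed_weight j :
  (weight (killed j) R <= budget p' R' H' j - budget p R H j)%R.
Proof.
have := stored_le j; have q_gt0 := pow2_gt0 j; have := wt_gt0 (tolerance H j).
rewrite /budget toleranceE; case: (ssrnat.ltngtP j i0) => [lt_j|gt_j|->].
- rewrite weight0 => [|r1 r1_in].
    by rewrite (threshold_le (ltnW lt_j)) add0n => _ /(ler_wpM2l (ltW q_gt0)); lra.
  apply/negP => /andP[/andP[lv nlv] /eqP E].
  by have := killed_low r1_in lv nlv; rewrite E; lia.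
(* The killed requests lie on 2^(j+1) branches, and by [inv_discount] their discounts reach the
   threshold. *)
- have : (weight (killed j) R <= (2 ^ j.+1)%:R * (2 * wt (threshold H j)))%R.
    apply: le_trans; last first.
      apply: (live_weight (p := p) (Q := fun r => threshold H j <= discount r)) => A _.
      apply: le_trans (branch_weight A _ pfU (inv_sound inv) (inv_improving inv)).
      by apply: leq_in_weight => r1 _ /andP[-> ->].
    apply: leq_in_weight => r1 r1_in /andP[/andP[lv nlv] /eqP E].
    rewrite lv E leqnn !andbT; apply: (inv_discount inv) => //; first by rewrite E.
  rewrite expnS natrM -/(pow2 j).
  have := captured_weight p H j pfU (inv_sound inv) (inv_improving inv).
  move/(ler_wpM2l (ltW q_gt0)).
  have := mulr_ge0 (ltW q_gt0) (weight_ge0 (captured p' H' j) R').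
  rewrite /stored (threshold_gt gt_j) (wtS (threshold H j)).
  rewrite /=; lra.
(* On each branch the requests beyond level [i0] weigh less than the tolerance, by [inv_gain]. *)
- have : (weight (killed i0) R <= (2 ^ i0.+1)%:R * wt (tolerance H i0))%R.
    apply: le_trans; last first.
      apply: (live_weight (p := p) (Q := fun r => i0 < level p (size (oracle_use r)))) => A pA.
      exact: ltW (inv_gain inv _ pA).
    apply: leq_in_weight => r1 r1_in /andP[/andP[lv nlv] /eqP E].
    by rewrite lv E !leqnn.
  rewrite expnS natrM -/(pow2 i0) (threshold_le (leqnn i0)) /=.
  case: (boolP b) => [_|/stored_unforced].
    rewrite add1n (wtS (tolerance H i0)) => + _ /(ler_wpM2l (ltW (pow2_gt0 i0))); lra.
  move=> /(ler_wpM2l (ltW (pow2_gt0 i0))) + + _ _; lra.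
Qed.

Lemma issue_invariant_act : consistent U (size X) p' R' H'.
Proof.
split=> //.
- by rewrite size_map size_iota.
- move=> A j p'A; have pA := branch_freeze template_le live_X p'A.
  rewrite toleranceE; case: (leqP i0 j) => [le_j|lt_j].
    (* After the action no string in use has more than [i0] free positions. *)
    rewrite weight0 ?wt_gt0 // => r1 /use_le le_X.
    by rewrite /beyond level_p' // negb_and -leqNgt geq_min le_j orbT.
  have -> : i0 == j = false by apply/eqP; lia.
  apply: le_lt_trans (gain_below pA (or_introl lt_j)).
  apply: leq_in_weight => r1 /use_le le_X /andP[lt_lev seg]; rewrite /beyond seg andbT.
  by move: lt_lev; rewrite level_p' // ltn_min => /andP[].
- move=> r1 j r1_in lv; rewrite level_p' ?use_le // ltn_min => /andP[lt_lev lt_j].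
  rewrite threshold_le ?(ltnW lt_j) //.
  move: r1_in lv lt_lev; rewrite inE => /predU1P[->|r1_in] lv lt_lev.
    exact: (not_wanted lt_j lt_lev).1.
  exact: (inv_discount inv r1_in (live_old lv) lt_lev).
- move=> J le_J; rewrite weight_cons /dead /=.
  have -> : live p' X by apply: live_freeze_segment => //; apply/initial_segmentP.
  (* The dead requests were dead before or are killed now; the latter are sorted by level. *)
  rewrite /= add0r (weight_split (fun r => ~~ live p (oracle_use r))).
  have -> : (\sum_(j < J) budget p' R' H' j =
    \sum_(j < J) budget p R H j + \sum_(j < J) (budget p' R' H' j - budget p R H j))%R.
    by rewrite -big_split; apply: eq_bigr => j _; rewrite /= addrC subrK.
  apply: lerD.
    apply: le_trans (inv_dead inv (leq_trans le_L le_J)).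
    by apply: leq_in_weight => r1 _ /andP[].
  apply: le_trans; last by apply: ler_sum => j _; exact: killed_weight.
  apply: le_trans (weight_le_levels (Q := fun r => live p (oracle_use r) && ~~ live p'
    (oracle_use r))
    (lev := fun r => level p (size (oracle_use r))) (i := i0) _).
    by apply: leq_in_weight => r1 _ /= /andP[-> /negPn ->].
  move=> r1 r1_in /andP[lv nlv]; rewrite killed_low //=.
  by rewrite (leq_trans (level_le _ _)) // (leq_trans (inv_use inv r1_in)) // (leq_trans le_L).
- move=> j; rewrite /forced /=; have := inv_forced inv j; rewrite /forced.
  have le_thr : threshold H j <= threshold H' j by rewrite thresholdE leq_addl.
  have : count (fun r => discount r < threshold H j) R <= count (fun r => discount r <
    threshold H' j) R.
    by apply: sub_count => r1 /= /leq_trans; apply.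
  (* A forced action comes with the new request [r], whose discount is below the threshold, so both
     sides grow by one. *)
  case: eqP => [<-|_] /=; last by lia.
  rewrite threshold_le // -/b; lia.
- move=> j; rewrite /unforced /= toleranceE natrD mulrDl.
  have := inv_unforced inv j; rewrite -/(unforced H j).
  have := stored_le j; have := stored_unforced.
  have : ((unforced H j)%:R * wt (((i0 == j) && b) + tolerance H j)
          <= (unforced H j)%:R * wt (tolerance H j))%R.
    by rewrite ler_wpM2l ?ler0n // leq_wt // leq_addl.
  case: (i0 =P j) => [<-|_] /=; last by lra.
  by case: (boolP b) => [_|nb] /=; [|rewrite add0n => + /(_ isT)]; lra.
Qed.
End Act.
End Issue.

Lemma issue_invariant U L st X tau sigma k : prefix_free_machine U ->
  consistent U L st.1 st.2.1 st.2.2 -> L <= size X -> live st.1 X ->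
  (forall A, initial_segment X A -> computes A U [:: strnum tau] sigma) ->
  ~~ satisfied st.2.1 sigma (size tau + k) ->
  let st' := issue st (sigma, (tau, (X, k))) in
  consistent U (size X) st'.1 st'.2.1 st'.2.2.
Proof.
case: st => p [R H] /= pfU inv le_L lv comp new; case: ltnP => lev.
  exact: (issue_invariant_act pfU inv le_L lv comp new lev).
exact: (issue_invariant_wait inv le_L lv comp new lev).
Qed.

(** * Total weight *)

Lemma pow2K j : (pow2 j * wt j = 1)%R.
Proof. exact: wtK. Qed.

Lemma sum_wt_lt2 J : (\sum_(j < J) wt j <= 2)%R.
Proof.
suff -> : (\sum_(j < J) wt j = 2 - 2 * wt J)%R by have := wt_ge0 J; lra.
elim: J => [|J IH]; first by rewrite big_ord0 wt0; ring.
by rewrite big_ord_recr /= IH; have := wtS J; lra.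
Qed.

Lemma stored_ub U p R H j : prefix_free_machine U -> sound U R -> improving R ->
  (stored p R H j <= 4 * pow2 j * wt (3 * j))%R.
Proof.
move=> pfU sR iR; have := captured_weight p H j pfU sR iR; rewrite /stored.
have := mulr_ge0 (ltW (pow2_gt0 j)) (wt_ge0 (threshold H j)); lra.
Qed.

(** Level j wastes at most 20 * 2^-j, so the dead requests weigh at most 40. The live ones weigh at
    most 2 at level 0 and 4 * 2^-j at level j + 1, in all 10; 64 is the next power of two. *)
Lemma total_weight U L p R H : prefix_free_machine U -> consistent U L p R H ->
  (weight predT R <= 64)%R.
Proof.
move=> pfU inv; have [sR iR] := (inv_sound inv, inv_improving inv).
have wt3 j : (pow2 j * wt (3 * j) = wt j * wt j)%R.
  by rewrite !mulSn mul0n addn0 !wtD mulrA pow2K mul1r.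
have wt2 j : (pow2 j * wt (2 * j) = wt j)%R.
  by rewrite !mulSn mul0n addn0 wtD mulrA pow2K mul1r.
have wt_sq j : (wt j * wt j <= wt j)%R.
  by rewrite -[leRHS]mulr1 ler_pM2l ?wt_gt0 // -wt0 leq_wt.
have dead_le : (weight (dead p) R <= 40)%R.
  apply: le_trans (inv_dead inv (leqnn L)) _.
  suff H20 j : (budget p R H j <= 20 * wt j)%R.
    apply: (@le_trans _ _ (\sum_(j < L) 20 * wt j)%R); first by apply: ler_sum => j _; exact: H20.
    by rewrite -mulr_sumr; have := sum_wt_lt2 L; lra.
  rewrite /budget; have := stored_ub p H j pfU sR iR => /(ler_wpM2l (ltW (pow2_gt0 j))).
  have := mulr_ge0 (ltW (pow2_gt0 j)) (wt_ge0 (threshold H j)).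
  have := mulr_ge0 (ltW (pow2_gt0 j)) (wt_ge0 (tolerance H j)).
  have -> : (pow2 j * (4 * pow2 j * wt (3 * j)) = 4 * wt j)%R.
    rewrite [LHS](_ : _ = 4 * pow2 j * (pow2 j * wt (3 * j)))%R; last by ring.
    rewrite wt3 [LHS](_ : _ = 4 * (pow2 j * wt j) * wt j)%R; last by ring.
    by rewrite pow2K mulr1.
  have := wt3 j; have := wt2 j; have := wt_sq j; lra.
have live_le : (weight (fun r => live p (oracle_use r)) R <= 10)%R.
  rewrite (weight_split (fun r => level p (size (oracle_use r)) <= 0)).
  have -> : (10 = 2 + 8 :> rat)%R by [].
  apply: lerD.
    apply: le_trans (_ : (2 ^ 0)%:R * (2 * wt 0) <= _)%R; last by rewrite wt0.
    apply: le_trans (@live_weight p predT R 0 (2 * wt 0)%R _).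
      by apply: leq_in_weight => r _ /andP[lv lev]; apply/and3P.
    move=> A _; apply: le_trans (branch_weight A 0 pfU sR iR).
    by apply: leq_in_weight => r _; rewrite leq0n andbT.
  apply: le_trans (@weight_le_levels _ (fun r => level p (size (oracle_use r))) 0 L _ _) _.
    move=> r r_in /andP[_]; rewrite -ltnNge => -> /=.
    exact: leq_trans (level_le _ _) (inv_use inv r_in).
  have -> : (8 = 4 * 2 :> rat)%R by [].
  apply: le_trans (_ : 4 * \sum_(j < L) wt j <= _)%R; last by rewrite ler_pM2l ?sum_wt_lt2.
  rewrite mulr_sumr; apply: ler_sum => j _.
  apply: le_trans (_ : (2 ^ j.+1)%:R * (2 * wt (threshold H j)) <= _)%R.
    apply: le_trans (@live_weight p (fun r => threshold H j <= discount r) R j.+1 _ _).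
      apply: leq_in_weight => r r_in /andP[/andP[lv _] /eqP E].
      by rewrite lv E leqnn !andbT; apply: (inv_discount inv) => //; rewrite E.
    move=> A _; apply: le_trans (branch_weight A (threshold H j) pfU sR iR).
    by apply: leq_in_weight => r _ /andP[-> ->].
  have le_thr : (wt (threshold H j) <= wt (3 * j))%R by rewrite leq_wt // leq_addl.
  have := ler_wpM2l (ltW (pow2_gt0 j)) le_thr.
  by rewrite expnS natrM -/(pow2 j) wt3; have := wt_sq j; lra.
rewrite (weight_split (fun r => live p (oracle_use r))) /=; move: dead_le live_le;
  rewrite /dead; lra.
Qed.

(** * The sequence of states *)

Lemma invariantW U L L' p R H : L <= L' -> consistent U L p R H -> consistent U L' p R H.
Proof.
move=> le_L [h1 h2 h3 h4 h5 h6 h7 h8 h9]; split=> //.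
- exact: leq_trans le_L.
- by move=> r /h2 le_r; exact: leq_trans le_L.
- by move=> J le_J; apply: h7; exact: leq_trans le_J.
Qed.

Definition consistent_state U L (st : state) := consistent U L st.1 st.2.1 st.2.2.

(** Histories only grow, so equality of the counts in [ext_undecided] says that no action of level
    at most i took place in between. *)
Record extends (st st' : state) : Prop := {
  ext_template : forall n b, nth None st.1 n = Some b -> nth None st'.1 n = Some b;
  ext_requests : exists l, st'.2.1 = l ++ st.2.1;
  ext_history : exists l, st'.2.2 = l ++ st.2.2;
  ext_undecided : forall i n, undecided st.1 n -> level st.1 n <= i ->
    count (fun h => h.1 <= i) st'.2.2 = count (fun h => h.1 <= i) st.2.2 ->
    undecided st'.1 n /\ level st'.1 n = level st.1 n
}.

Lemma extends_refl st : extends st st.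
Proof. by split=> //; exists [::]. Qed.

Lemma extends_trans st2 st1 st3 : extends st1 st2 -> extends st2 st3 -> extends st1 st3.
Proof.
move=> [t1 [l1 E1] [k1 F1] u1] [t2 [l2 E2] [k2 F2] u2]; split=> [n b /t1/t2 //|||].
- by exists (l2 ++ l1); rewrite E2 E1 catA.
- by exists (k2 ++ k1); rewrite F2 F1 catA.
move=> i n un le_i Ecount.
have c2 : count (fun h => h.1 <= i) st2.2.2 = count (fun h => h.1 <= i) st1.2.2.
  by move: Ecount; rewrite F2 F1 !count_cat; lia.
have [un2 E] := u1 i n un le_i c2; have le2 : level st2.1 n <= i by rewrite E.
have [un3 E3] := u2 i n un2 le2 (etrans Ecount (esym c2)).
by rewrite E3.
Qed.

Lemma issue_extends st r : size st.1 <= size (oracle_use r) -> live st.1 (oracle_use r) ->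
  extends st (issue st r).
Proof.
case: st => p [R H] /= sz lv; case: ifP => act; split=> //=.
- by move=> n b; exact: nth_freeze_old.
- by exists [:: r].
- by eexists [:: _].
- move=> i n un le_i; case: leqP => [_|lt_i _]; first by move=> /= ?; lia.
  have lt_n : n < size (oracle_use r).
    by rewrite ltnNge; apply/negP => /(leq_level p); lia.
  split; first by rewrite /undecided nth_freeze lt_n un (leq_ltn_trans le_i lt_i).
  rewrite (level_freeze _ sz lv (ltnW lt_n)); apply/minn_idPl.
  exact: ltnW (leq_ltn_trans le_i lt_i).
- by exists [:: r].
- by exists [::].
Qed.

Lemma foldl_extends T (F : state -> T -> state) (I : state -> Prop) s st :
  (forall st x, I st -> I (F st x) /\ extends st (F st x)) -> I st ->
  I (foldl F st s) /\ extends st (foldl F st s).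
Proof.
move=> HF; elim: s st => [|x s IH] st Ist /=; first by split=> //; exact: extends_refl.
have [IF eF] := HF st x Ist; have [? e'] := IH _ IF; split=> //; exact: extends_trans e'.
Qed.

Section Run.
Variables (U : program) (fs : nat -> seq bool -> nat).
Hypothesis pfU : prefix_free_machine U.

(** Links small discounts to the finitely many strings on which the approximation is ever small. *)
Definition genuine (R : seq request) :=
  forall r, r \in R -> exists t, discount r = fs t (numstr (target r)).

Lemma process_step X tau st :
  consistent_state U (size X) st /\ genuine st.2.1 ->
  (consistent_state U (size X) (process U fs st X tau) /\ genuine (process U fs st X tau).2.1)
  /\ extends st (process U fs st X tau).
Proof.
move=> [inv gen]; rewrite /process.
case E: (ev _ _ _ _) => [sigma|]; last by split=> //; exact: extends_refl.
case: ifP => [/andP[lv new]|_]; last by split=> //; exact: extends_refl.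
split; last by apply: issue_extends => //; exact: inv_template inv.
split.
  apply: (issue_invariant pfU inv (leqnn _) lv _ new) => A.
  by rewrite initial_segment_mkseq => /eqP EX; move: E; rewrite {2}EX; exact: ev_sound.
case: st {inv lv new E} gen => p [R H] /= gen.
have gen' : genuine ((sigma, (tau, (X, fs (size X) (numstr sigma)))) :: R).
  by move=> r; rewrite inE => /predU1P[->|/gen //]; exists (size X).
by case: ifP.
Qed.

Lemma stage_step X st :
  consistent_state U (size X) st /\ genuine st.2.1 ->
  (consistent_state U (size X) (stage U fs st X) /\ genuine (stage U fs st X).2.1)
  /\ extends st (stage U fs st X).
Proof.
apply: (@foldl_extends _ _ (fun st => consistent_state U (size X) st /\ genuine st.2.1)) => st1 m.
exact: process_step.
Qed.

Lemma run_invariant n : consistent_state U (size (numstr n)) (run U fs n) /\ genuine (run U fs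
  n).2.1.
Proof.
elim: n => [|n IH].
  split=> //; split=> //.
  - by move=> A j _; rewrite /weight big_nil wt_gt0.
  - move=> J _; rewrite big1 ?/weight ?big_nil // => j _.
    by rewrite /budget /stored /threshold /tolerance /weight /= big_nil !add0n !subrr !(mulr0,
      addr0).
  - by move=> j; rewrite /stored /threshold /weight /= big_nil mul0r add0n subrr mulr0 addr0.
have [[inv gen] _] := stage_step IH.
by split=> //; apply: invariantW inv; exact: leq_size_numstr.
Qed.

Lemma run_extends m n : m <= n -> extends (run U fs m) (run U fs n).
Proof.
move=> /subnKC <-; elim: (n - m) => [|k IH]; first by rewrite addn0; exact: extends_refl.
rewrite addnS; apply: extends_trans IH _.
by have [_] := stage_step (run_invariant (m + k)).
Qed.

Lemma extends_branch st st' A : extends st st' -> branch st'.1 A -> branch st.1 A.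
Proof. by move=> ext /branchP HA; apply/branchP => n b /(ext_template ext)/HA. Qed.

(** As A is a branch of every template, its initial segment of length n is live when its turn comes;
    a request is then issued unless an equally short one exists. *)
Lemma stage_satisfies A tau sigma n m :
  (forall m, branch (run U fs m).1 A) ->
  strnum tau < n -> ev n (mkseq A n) U [:: strnum tau] = Some sigma ->
  strnum (mkseq A n) = m ->
  satisfied (run U fs m.+1).2.1 sigma (size tau + fs n (numstr sigma)).
Proof.
move=> HA lt_n Eev Em; set X := mkseq A n; have szX : size X = n by rewrite size_mkseq.
have step := @foldl_extends _ (fun st m => process U fs st X (numstr m))
  (fun st => consistent_state U (size X) st /\ genuine st.2.1)
  _ _ (fun st k => @process_step X (numstr k) st).
have inv := run_invariant m; rewrite -Em strnumK in inv.
have : run U fs m.+1 = stage U fs (run U fs m) X by rewrite [LHS]/= -/(run U fs m) -Em strnumK.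
rewrite /stage szX.
have -> : iota 0 n = iota 0 (strnum tau) ++ strnum tau :: iota (strnum tau).+1 (n - (strnum
  tau).+1).
  by rewrite -{1}(subnKC lt_n) addSnnS iotaD add0n.
rewrite foldl_cat /= (strnumK tau) -Em; have [] := step (iota 0 (strnum tau)) _ inv;
  set st1 := foldl _ _ _ => inv1 ext1.
have [] := process_step tau inv1; rewrite strnumK; set st2 := process _ _ _ _ _ => inv2 ext2.
have [] := step (iota (strnum tau).+1 (n - (strnum tau).+1)) _ inv2.
set st3 := foldl _ _ _ => inv3 ext3 Erun; rewrite Erun.
have [l ->] := ext_requests ext3; rewrite /satisfied has_cat; apply/orP; right.
rewrite /st2 /process szX Eev; case: ifP => [_|].
  case: (st1) => p [R H] /=; case: ifP => _ /=; by rewrite eqxx leqnn.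
(* The remaining case, that X is not live, contradicts that A is a branch of the later template. *)
case: (boolP (satisfied _ _ _)) => //= _; rewrite andbT => /negP[].
have /branchP HB : branch st1.1 A.
  apply: extends_branch ext2 _; apply: extends_branch ext3 _; rewrite -Erun.
  by have := HA (strnum (mkseq A n)).+1; rewrite [run _ _ _]/= strnumK.
apply/compatibleP => i b; rewrite szX => lt_i /HB <-; by rewrite nth_mkseq.
Qed.
End Run.

(** * Every level acts finitely often *)

(** Requests for one target have distinct lengths. *)
Lemma improving_count R x N : improving R ->
  (forall r, r \in R -> target r = x -> length_req r < N) ->
  count (fun r => target r == x) R <= N.
Proof.
move=> impR lt_N; rewrite -size_filter -(size_map length_req) -[N in _ <= N](size_iota 0).
apply: uniq_leq_size => [|_ /mapP[r + ->]]; last first.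
  by rewrite mem_filter mem_iota => /andP[/eqP E r_in] /=; exact: lt_N.
apply: (@pairwise_uniq _ ltn) => [n|]; first exact: ltnn.
rewrite pairwise_map; have := pairwise_filter (fun r => target r == x) impR.
apply: sub_in_pairwise (allss _) => r r'; rewrite !mem_filter.
by move=> /andP[/eqP -> _] /andP[/eqP -> _]; rewrite eqxx.
Qed.

(** The number x + 1 is the least bound below which P has more than i elements. *)
Lemma rank_attained (P : pred nat) i : (forall n, exists2 x, n <= x & P x) ->
  exists2 x, P x & count P (iota 0 x) = i.
Proof.
move=> Pinf; have countS x : count P (iota 0 x.+1) = count P (iota 0 x) + P x.
  by rewrite -addn1 iotaD count_cat /= addn0.
have ex_y : exists y, i < count P (iota 0 y).
  elim: i => [|i [y lt_i]].
    by have [x _ Px] := Pinf 0; exists x.+1; rewrite countS Px addn1.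
  have [x le_x Px] := Pinf y; exists x.+1; rewrite countS Px addn1 ltnS (leq_trans lt_i) //.
  by rewrite -(subnKC le_x) iotaD count_cat leq_addr.
case: (ex_minnP ex_y) => -[//|x]; rewrite countS => lt_i min_x; exists x.
  by case: (P x) lt_i => //; rewrite addn0 => /min_x; rewrite ltnn.
apply/eqP; rewrite eqn_leq; apply/andP; split; last by case: (P x) lt_i; lia.
by rewrite leqNgt; apply/negP => /min_x; rewrite ltnn.
Qed.

Lemma level_attained p i : exists2 x, undecided p x & level p x = i.
Proof.
apply: rank_attained => n; exists (maxn n (size p)); first exact: leq_maxl.
by rewrite /undecided nth_default // leq_maxr.
Qed.

Section Finiteness.
Variables (U : program) (fs : nat -> seq bool -> nat).
Hypothesis pfU : prefix_free_machine U.
Hypothesis hinf : forall i : nat,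
  finite_set [set sigma | ~ forall s, fs s sigma > i]%classic.

Let run := run U fs.
Let run_ext m n : m <= n -> extends (run m) (run n).
Proof. exact: run_extends. Qed.

(** All later requests for x are shorter than a given one, and of distinct lengths. *)
Lemma target_bounded x : exists M, forall n, count (fun r => target r == x) (run n).2.1 <= M.
Proof.
have [[m /hasP[r0 r0_in /eqP r0x]]|none] := pselect (exists m, has (fun r => target r == x)
  (run m).2.1); last first.
  by exists 0 => n; rewrite leqNgt -has_count; apply/negP => H; apply: none; exists n.
exists (count (fun r => target r == x) (run m).2.1 + length_req r0) => n.
case: (leqP n m) => [le_n|lt_m].
  by have [l ->] := ext_requests (run_ext le_n); rewrite count_cat; lia.
have [[inv _] ext] := (run_invariant fs pfU n, run_ext (ltnW lt_m)).
have [l E] := ext_requests ext; have := inv_improving inv; rewrite -/run E count_cat.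
rewrite /improving pairwise_cat => /and3P[/allrelP rel impl _].
rewrite addnC leq_add2l; apply: improving_count => // r r_in rx.
by have := rel r r0 r_in r0_in; rewrite rx r0x eqxx.
Qed.

Lemma targets_bounded (s : seq nat) : exists M, forall n, count (fun r => target r \in s) (run
  n).2.1 <= M.
Proof.
elim: s => [|x s [M HM]]; first by exists 0 => n; rewrite leqn0; apply/eqP/count_pred0.
have [M' HM'] := target_bounded x; exists (M' + M) => n.
apply: leq_trans (leq_add (HM' n) (HM n)); rewrite -count_predUI.
by apply: leq_trans (leq_addr _ _); apply: sub_count => r; rewrite /= inE.
Qed.

Lemma discount_bounded b : exists M, forall n, count (fun r => discount r < b) (run n).2.1 <= M.
Proof.
have [s Es] := (finite_seqP _).1 (hinf b); have [M HM] := targets_bounded [seq strnum x | x <- s].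
exists M => n; apply: leq_trans (HM n); rewrite -!size_filter.
have [_ gen] := run_invariant fs pfU n; rewrite -/run in gen.
have -> : [seq r <- (run n).2.1 | discount r < b] =
    [seq r <- [seq r <- (run n).2.1 | discount r < b] | target r \in [seq strnum x | x <- s]].
  rewrite -filter_predI; apply: eq_in_filter => r r_in /=.
  case: (ltnP (discount r) b) => [lt_b|_]; rewrite ?andbF // andbT; apply/esym.
  have [t Et] := gen r r_in; rewrite -[target r]numstrK map_f //.
  have : [set` s]%classic (numstr (target r)); last by [].
  by rewrite -Es /= => /(_ t); rewrite -Et; lia.
by rewrite -filter_predI !size_filter; apply: sub_count => r /andP[].
Qed.

(** By induction the threshold of j is bounded, so only finitely many requests have a discount below
    it and force level j. Then the tolerance is bounded too, and the unforced actions each store a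
    fixed amount. *)
Lemma actions_bounded j : exists M, forall n, count (fun h => h.1 < j) (run n).2.2 <= M.
Proof.
elim: j => [|j [M HM]]; first by exists 0 => n; rewrite leqn0; apply/eqP/count_pred0.
have [M1 HM1] := discount_bounded (M + 3 * j).
have forced_le n : forced (run n).2.2 j <= M1.
  have [inv _] := run_invariant fs pfU n; apply: leq_trans (inv_forced inv j) (leq_trans _ (HM1 n)).
  by apply: sub_count => r /= /leq_trans; apply; rewrite leq_add2r HM.
(* [stored] never exceeds 4, and each unforced action accounts for at least [wt (M1 + 2 * j)] of
   it. *)
exists (M + (M1 + 4 * 2 ^ (M1 + 2 * j))) => n.
have -> : count (fun h => h.1 < j.+1) (run n).2.2 =
    count (fun h => h.1 < j) (run n).2.2 + (forced (run n).2.2 j + unforced (run n).2.2 j).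
  elim: (run n).2.2 => //= -[i b] H ->; rewrite /forced /unforced /=.
  by rewrite ltnS; case: (ssrnat.ltngtP i j); case: b => /=; lia.
apply: leq_add (HM n) (leq_add (forced_le n) _).
have [inv _] := run_invariant fs pfU n.
have tol : tolerance (run n).2.2 j <= M1 + 2 * j by rewrite leq_add2r forced_le.
have := inv_unforced inv j; have := stored_ub (run n).1 (run n).2.2 j pfU (inv_sound inv)
  (inv_improving inv).
have wt3 : (pow2 j * wt (3 * j) <= 1)%R by rewrite -(pow2K j) ler_pM2l ?pow2_gt0 // leq_wt; lia.
move=> up low; rewrite -(ler_nat rat) natrM.
have H4 : ((unforced (run n).2.2 j)%:R * wt (M1 + 2 * j) <= 4)%R.
  apply: le_trans (_ : (unforced (run n).2.2 j)%:R * wt (tolerance (run n).2.2 j) <= _)%R.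
    by rewrite ler_wpM2l ?ler0n // leq_wt.
  by move: up low wt3; rewrite -mulrA; lra.
rewrite -(ler_pM2r (wt_gt0 (M1 + 2 * j))) -mulrA wtK mulr1; exact: H4.
Qed.

(** At a stage [s0] after which no action of level at most i occurs, the free position preceded by i
    free ones is permanent. *)
Lemma undecided_forever i : exists2 x, i <= x & forall s, undecided (run s).1 x.
Proof.
have [M HM] := actions_bounded i.+1.
pose c s := count (fun h => h.1 <= i) (run s).2.2.
have ex_v : exists v, `[< exists s, c s = v >] by exists (c 0); apply/asboolP; exists 0.
have v_le v : `[< exists s, c s = v >] -> v <= M by move=> /asboolP[s <-]; exact: HM.
case: (ex_maxnP ex_v v_le) => _ /asboolP[s0 <-] max_c.
have [x ux lev_x] := level_attained (run s0).1 i; exists x.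
  by rewrite -lev_x level_le.
move=> s; case: (leqP s0 s) => [le_s|lt_s].
  have ext := run_ext le_s; have [] // := ext_undecided ext (i := i) ux; first by rewrite lev_x.
  apply/eqP; rewrite eqn_leq; apply/andP; split.
    by apply: max_c; apply/asboolP; exists s.
  by have [l ->] := ext_history ext; rewrite count_cat leq_addl.
have ext := run_ext (ltnW lt_s); rewrite /undecided.
case E: (nth None (run s).1 x) => [b|//].
by move: ux; rewrite /undecided (ext_template ext E).
Qed.
End Finiteness.

(** * Computability of the construction *)

Section ComputableRun.
Variable O : (nat -> bool) -> Prop.

Lemma computable_filter {S T} {eS : Enc S} {eT : Enc T} (F : S -> T -> bool) (s : S -> seq T) :
  computable O s -> computable O (fun p : S * T => F p.1 p.2) ->
  computable O (fun x => [seq u <- s x | F x u]).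
Proof.
move=> Hs HF.
apply: (computable_ext (f := fun x => foldr (fun u r => if F x u then u :: r else r) [::] (s
  x))) => //.
apply: computable_foldr => //; computability.
by apply: (computable_comp (f := fun p : S * (T * seq T) => (p.1, p.2.1)) HF); computability.
Qed.

Lemma computable_undecided {S} {eS : Enc S} (p : S -> seq (option bool)) n :
  computable O p -> computable O n -> computable O (fun x => undecided (p x) (n x)).
Proof.
move=> Hp Hn; apply: (computable_ext (f := fun x => if nth None (p x) (n x) is Some _ then
  false else true)).
  by move=> x; rewrite /undecided; case: (nth _ _ _).
by computability.
Qed.

Lemma computable_level {S} {eS : Enc S} (p : S -> seq (option bool)) n :
  computable O p -> computable O n -> computable O (fun x => level (p x) (n x)).
Proof.
by move=> Hp Hn; rewrite /level; computability; apply: computable_undecided; computability.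
Qed.

Lemma computable_live {S} {eS : Enc S} (p : S -> seq (option bool)) (X : S -> seq bool) :
  computable O p -> computable O X -> computable O (fun x => live (p x) (X x)).
Proof. by move=> Hp HX; rewrite /live /compatible; computability. Qed.

Lemma computable_freeze {S} {eS : Enc S} (p : S -> seq (option bool)) (X : S -> seq bool) i :
  computable O p -> computable O X -> computable O i ->
  computable O (fun x => freeze (p x) (X x) (i x)).
Proof.
move=> Hp HX Hi; rewrite /freeze; computability.
  by apply: computable_undecided; computability.
by apply: computable_level; computability.
Qed.

Local Notation requestE := (nat * (seq bool * (seq bool * nat)))%type.

Lemma computable_action_level {S} {eS : Enc S} (p : S -> seq (option bool))
    (R : S -> seq requestE) (H : S -> seq (nat * bool)) (X : S -> seq bool) k :
  computable O p -> computable O R -> computable O H -> computable O X -> computable O k ->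
  computable O (fun x => action_level (p x) (R x) (H x) (X x) (k x)).
Proof.
move=> Hp HR HH HX Hk; rewrite /action_level /wants /threshold /tolerance /large_gain.
apply: computable_find; first by computability; apply: computable_level; computability.
have Hgain : computable O (fun q : S * nat =>
    dyadic_sum (gain_list (p q.1) (R q.1) (nth false (X q.1)) q.2)).
  rewrite /dyadic_sum /gain_list /beyond /initial_segment /length_req /source /discount /oracle_use.
  computability; apply: computable_filter; computability.
  by apply: computable_level; computability.
by computability.
Qed.

Lemma computable_process U fs {S} {eS : Enc S} (st : S -> seq (option bool) * (seq requestE *
  seq (nat * bool)))
    (X tau : S -> seq bool) :
  computable O (fun q : nat * nat => fs q.1 (numstr q.2)) ->
  computable O st -> computable O X -> computable O tau ->
  computable O (fun x => process U fs (st x) (X x) (tau x)).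
Proof.
move=> Hfs Hst HX Htau; rewrite /process.
apply: computable_case_option; last 1 [idtac] || idtac.
- apply: computable_ev; [by computability | by [] |].
  by computability; apply: computable_strnum.
- by [].
have Hk : computable O (fun q : S * nat => fs (size (X q.1)) (numstr q.2)).
  by apply: (computable_comp (f := fun q : S * nat => (size (X q.1), q.2)) Hfs); computability.
apply: computable_if; last by computability.
  rewrite /satisfied /target /length_req /source /discount; computability.
    by apply: computable_live; computability.
  by apply: (computable_comp (f := fst) Hk); computability.
pose r (q : S * nat) : requestE := (q.2, (tau q.1, (X q.1, fs (size (X q.1)) (numstr q.2)))).
have Hr : computable O r by rewrite /r; computability.
have Hi : computable O (fun q => action_level (st q.1).1 (r q :: (st q.1).2.1) (st q.1).2.2
    (X q.1) (fs (size (X q.1)) (numstr q.2))).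
  by apply: computable_action_level; computability.
(* [issue], with projections in place of the pattern matching on the state. *)
pose g (q : S * nat) : seq (option bool) * (seq requestE * seq (nat * bool)) :=
  let i := action_level (st q.1).1 (r q :: (st q.1).2.1) (st q.1).2.2
    (X q.1) (fs (size (X q.1)) (numstr q.2)) in
  if i < level (st q.1).1 (size (X q.1)) then
    (freeze (st q.1).1 (X q.1) i, (r q :: (st q.1).2.1,
      (i, fs (size (X q.1)) (numstr q.2) < threshold (st q.1).2.2 i) :: (st q.1).2.2))
  else ((st q.1).1, (r q :: (st q.1).2.1, (st q.1).2.2)).
have Hg : computable O g.
  rewrite /g /= /threshold; computability.
  - by apply: computable_level; computability.
  - by apply: computable_freeze; computability.
  - by apply: (computable_comp (f := fst) Hi); computability.
by apply: computable_ext _ Hg => q; rewrite /g /issue; case: (st q.1) => p [R H].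
Qed.

Lemma computable_run U fs :
  computable O (fun q : nat * nat => fs q.1 (numstr q.2)) ->
  computable O (run U fs : nat -> seq (option bool) * (seq requestE * seq (nat * bool))).
Proof.
move=> Hfs; rewrite /run /stage; computability; try by apply: computable_numstr; computability.
by apply: computable_process => //; computability; apply: computable_numstr; computability.
Qed.
End ComputableRun.

(** * From the construction to the class of reals *)

Local Open Scope classical_set_scope.

Lemma recursive_approximation_computable O fs : recursive_approximation fs ->
  computable O (fun q : nat * nat => fs q.1 (numstr q.2)).
Proof.
move=> [e He]; exists (Comp (strip e) [:: fst_prog; snd_prog]) => A [s n] _.
apply: computes_comp2 (computes_fst _ _ _) (computes_snd _ _ _) _.
by apply/computes_strip; have := He s (numstr n); rewrite numstrK.
Qed.

Lemma not_isolated (P : set cantor_space) (A : cantor_space) :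
  (forall n, exists B, [/\ P B, B <> A & forall i, i < n -> B i = A i]) ->
  ~ isolated P A.
Proof.
move=> HB [_ [V nV VP]].
have [g Hg] := choice HB.
(* In the product topology single coordinates suffice: [g i] agrees with A at N once i > N. *)
have gcvg : g @ \oo --> A.
  apply/cvg_sup => N W [V' [[W' oW' <-] W'N V'W]].
  apply: (filterS V'W); rewrite nbhs_simpl; exists N.+1 => // i /= lt_N.
  by have [_ _ /(_ N lt_N) E] := Hg i; rewrite /= E.
have [n _ Vn] := gcvg V nV.
have [Pg neq _] := Hg n; apply: neq.
have : (V `&` P) (g n) by split=> //; exact: Vn (leqnn n).
by rewrite VP.
Qed.

(** The join recognizes the positions where A and B differ; a search finds the one of rank n, where
    A has the value C n. *)
Lemma join_computes_difference (C A B : cantor_space) :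
  (forall n, exists2 x, A x != B x & count (fun y => A y != B y) (iota 0 x) = n) ->
  (forall x, A x != B x -> A x = C (count (fun y => A y != B y) (iota 0 x))) ->
  turing_le C (turing_join A B).
Proof.
move=> Hrank HC; set D := turing_join A B.
have DA x : D (x + x) = A x by rewrite /D /turing_join addnn odd_double doubleK.
have DB x : D (x + x).+1 = B x.
  by rewrite /D /turing_join addnn /= odd_double uphalf_double.
have HD : computable (eq D) (D : nat -> bool) by exists Oracle => _ x <-.
pose differ x := D (x + x) != D (x + x).+1.
have differE : differ =1 (fun y => A y != B y) by move=> x; rewrite /differ DA DB.
pose F x n := if differ x && (count differ (iota 0 x) == n) then Some (nat_of_bool (D (x + x)))
  else None.
have [|M HM] := @search_machine (eq D) F; first by rewrite /F /differ; computability.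
have FC x n y : F x n = Some y -> y = C n.
  rewrite /F differE (eq_count differE); case: ifP => // /andP[dx /eqP <-] [<-].
  by rewrite DA HC.
exists M => n; have [x dx rx] := Hrank n.
have [|y Hy] := (HM D n erefl).2 x.
  by rewrite /F differE (eq_count differE) dx rx eqxx.
by have [x' /FC <-] := (HM D n erefl).1 y Hy.
Qed.

Theorem theorem1p7 (U : program) (hU : universal_machine U)
    (f : seq bool -> nat) (fs : nat -> seq bool -> nat)
    (hfs : recursive_approximation fs)
    (hlim : forall sigma, \forall s \near \oo, fs s sigma = f sigma)
    (hinf : forall i : nat,
       finite_set [set sigma | ~ forall s, fs s sigma > i]) :
  exists (P : set cantor_space) (c : nat),
    [/\ Pi01_class P,
        perfect P,
        forall A, P A -> forall sigma,
          K U sigma <= K_rel U A sigma + f sigma + c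
      & forall C : cantor_space,
          exists A B, [/\ P A, P B & turing_le C (turing_join A B)]].
Proof.
have [pfU univ] := hU; pose st := run U fs.
have st_ext m n : m <= n -> extends (st m) (st n) by exact: run_extends.
have comp_st := computable_run U (recursive_approximation_computable xpredT hfs).
(* A string is tested against the template of stage [size s] only; positions fixed later are noticed
   by its extensions. *)
pose T s := live (st (size s)).1 s.
pose P := paths T.
have PE A : P A <-> forall s, branch (st s).1 A.
  have TE n : T (mkseq A n) = compatible (st n).1 A n.
    rewrite /T /live size_mkseq /compatible; apply: eq_in_all => i;
      rewrite mem_iota /= add0n => lt_i.
    by rewrite nth_mkseq.
  split=> [PA s|HA n]; last by rewrite TE; exact: (HA n n).
  apply/branchP => n b E; pose m := maxn s n.+1.
  have := PA m; rewrite TE => /compatibleP; apply; first exact: leq_maxr.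
  exact: ext_template (st_ext s m (leq_maxl _ _)) _ _ E.
(* The set D of positions that are never fixed. *)
pose und n := `[< forall s, undecided (st s).1 n >].
have und_inf n : exists2 x, n <= x & und x.
  by have [x le_x ux] := undecided_forever pfU hinf n; exists x => //; apply/asboolP.
have frozen n : exists c, forall s b, nth None (st s).1 n = Some b -> c = b.
  have [[s [b E]]|none] := pselect (exists s b, nth None (st s).1 n = Some b).
    exists b => s' b' E'.
    have E1 := ext_template (st_ext _ _ (leq_maxl s s')) E.
    by have := ext_template (st_ext _ _ (leq_maxr s s')) E'; rewrite E1 => -[].
  by exists false => s b E; case: none; exists s, b.
(* [Z] has the final value at every position that is ever fixed; a real that agrees with it off
   [und] is in [P]. *)
have [Z HZ] := choice frozen.
have in_P A : (forall n, ~~ und n -> A n = Z n) -> P A.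
  move=> HA; apply/PE => s; apply/branchP => n b E; rewrite HA ?(HZ _ _ _ E) //.
  by apply/asboolP => /(_ s); rewrite /undecided E.
have in_PN A n b s : P A -> nth None (st s).1 n = Some b -> A n = b.
  by move=> /PE /(_ s) /branchP; apply.
(* Six more bits bring the total weight from 64 down to 1. *)
pose L s := [seq (length_req r + 6, target r) | r <- (st s).2.1].
have [||s|M Mpf HM] := @kraft_chaitin L.
- rewrite /L /length_req /target /source /discount; computability.
- move=> s; have [l E] := ext_requests (st_ext _ _ (leqnSn s)).
  by exists [seq (length_req r + 6, target r) | r <- l]; rewrite /L E map_cat.
- rewrite /L big_map /=; under eq_bigr => r _ do rewrite wtD.
  rewrite -mulr_suml; have [inv _] := run_invariant fs pfU s.
  have := total_weight pfU inv; rewrite /weight => le64.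
  have -> : (1 = 64 * wt 6)%R by [].
  by rewrite ler_pM2r ?wt_gt0.
have [d Hd] := univ M Mpf.
(* Six bits from [L], one from the Kraft-Chaitin machine and d from the simulation by U. *)
exists P, (7 + d); split.
- exists T => //; split.
    have [e He] : computable xpredT (fun n => T (numstr n)).
      rewrite /T; apply: computable_live; last by apply: computable_numstr; computability.
      computability; apply: computable_numstr; computability.
    by exists e => sigma; have := He no_oracle (strnum sigma) isT; rewrite strnumK.
  move=> s t pre /compatibleP lt; apply/compatibleP => n b lt_n E.
  have Et := ext_template (st_ext _ _ (size_prefix pre)) E.
  rewrite -(lt n b (leq_trans lt_n (size_prefix pre)) Et).
  by have [r ->] := prefixP pre; rewrite nth_cat lt_n.
- split; first by exists Z; exact: in_P.
  apply/seteqP; split=> // A isoA; case: (not_isolated _ isoA) => n.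
  have [x le_x /asboolP ux] := und_inf n.
  (* Flipping a permanently free position beyond n stays in [P]. *)
  exists (fun i => if i == x then ~~ A i else A i); split.
  + apply/PE => s; apply/branchP => i b E; case: eqP => [ix|_].
      by have := ux s; rewrite /undecided -ix E.
    by apply: in_PN E; exact: isolatedS isoA.
  + by move/(congr1 (@^~ x)); rewrite eqxx; case: (A x).
  + by move=> i lt_i; case: eqP => // E; move: lt_i; rewrite E ltnNge le_x.
- move=> A PA sigma.
  have [tau Htau <-] := K_rel_attained (universal_describes A sigma hU).
  have [N HN] := ev_complete Htau; have [N' _ HN'] := hlim sigma.
  (* Long enough for the computation to halt, for the approximation to have settled at sigma, and
     for tau to be among the inputs tried with a string of length n. *)
  pose n := maxn (maxn N N') (strnum tau).+1.
  have Hn : [/\ N <= n, N' <= n & strnum tau < n] by rewrite /n; split; lia.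
  have [nN nN' ntau] := Hn.
  have := @stage_satisfies U fs pfU A tau (strnum sigma) n _ _ ntau (HN n n nN nN) erefl.
  rewrite strnumK (HN' n nN') => /(_ ((PE A).1 PA))/hasP[r r_in /andP[/eqP rs len_r]].
  have [|t sz_t Ht] := HM no_oracle (strnum (mkseq A n)).+1 (length_req r + 6) (target r).
    by rewrite /L (map_f (fun r => (length_req r + 6, target r))).
  rewrite rs strnumK in Ht.
  have [t' Ht' sz_t'] := Hd _ _ _ Ht.
  apply: leq_trans (K_rel_le Ht') _; lia.
(* A carries C along [und]; B is its complement there, so that the two differ exactly on [und]. *)
- move=> C; pose A n := if und n then C (count und (iota 0 n)) else Z n.
  pose B n := if und n then ~~ C (count und (iota 0 n)) else Z n.
  have ABE n : (A n != B n) = und n.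
    by rewrite /A /B; case: (und n); [case: (C _) | rewrite eqxx].
  exists A, B; split.
  + by apply: in_P => n /negPf; rewrite /A => ->.
  + by apply: in_P => n /negPf; rewrite /B => ->.
  apply: join_computes_difference => [n|x].
    have [x ux rx] := rank_attained n und_inf; exists x; first by rewrite ABE.
    by rewrite (eq_count ABE).
  by rewrite (eq_count ABE) ABE /A => ->.
Qed.
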